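(* Let $n=\dim M=4$, and let $(\theta,\omega)$, $\theta\in\Omega^{11}$ nondegenerate and $\omega\in\Omega^{21}$, be a pair with vanishing torsion $d\theta+\omega\theta+\theta\omega=0$ and curvature $R=d\omega+\omega^2\in\Omega^{22}$. Then the Einstein equation $FR=0$ (vanishing of the Ricci tensor), together with the first Bianchi identity $E'R=0$, is equivalent to the invariance of $R$ under $\mathfrak{sl}_2\times\mathfrak{sl}_2$, i.e. to $$ER=FR=HR=E'R=F'R=H'R=0 .$$ This invariance implies that $R$ is symmetric as a function with values in $\Lambda^2(\mathrm V)\otimes\Lambda^2(\mathrm V)$ and self-dual, i.e. $*_1*_2R=R$; equivalently, in the decomposition $R=R_{++}+R_{+-}+R_{-+}+R_{--}$ according to the eigenvalues $\pm1$ of the commuting involutions $*_1,*_2$ of $\Omega^{22}$, one has $R_{+-}=R_{-+}=0$.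
   Context: $\mathrm V$ is an $n$-dimensional vector space (here $n=4$) with nondegenerate symmetric bilinear form $\eta$. The Clifford algebra $Cl(\mathrm V)$ is generated by $\mathrm V$ with relations $vv'+v'v=2\eta(v,v')$; coefficients are complexified whenever needed. For $v\in\mathrm V$ and $a\in Cl(\mathrm V)$ of parity $\deg a$ put $v\wedge a=\frac12(va+(-1)^{\deg a}av)$ and $v\vdash a=\frac12(va-(-1)^{\deg a}av)$; each defines an action of $\Lambda(\mathrm V)$ on $Cl(\mathrm V)$. The map $x\mapsto x\wedge1$ is a linear isomorphism $\Lambda(\mathrm V)\to Cl(\mathrm V)$ and $Cl^i(\mathrm V)$ is the image of $\Lambda^i(\mathrm V)$. Fix $\mathbf v\in Cl^n(\mathrm V)$ with $\mathbf v^2=1$. The Hodge star $*$ is the linear automorphism of $Cl(\mathrm V)\cong\Lambda(\mathrm V)$ with $*\mathbf v=1$ and $v\wedge( *a)=*(v\vdash a)$. Clifford forms: $\Omega^{pq}=\Omega^q(M,Cl^p(\mathrm V))$ with multiplication $(a\otimes\alpha)(b\otimes\beta)=ab\otimes\alpha\wedge\beta$ (no extra sign). $\theta\in\Omega^{11}$ is nondegenerate if $X\mapsto i_X\theta$ is an isomorphism $T_mM\to\mathrm V$ at every point; then $\theta=\xi_i\otimes\xi^i$ for a basis $\xi_i$ of $\mathrm V$ and a coframe $\xi^i$, which identifies $T^*_mM$ with $\mathrm V^*$, and $\eta$ identifies $\mathrm V^*$ with $\mathrm V$, so that elements of $\Omega^{22}$ are functions with values in $\Lambda^2(\mathrm V)\otimes\Lambda^2(\mathrm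 V)$. The operator $*_1:\Omega^{pq}\to\Omega^{n-p,q}$ is the Hodge star on the Clifford factor and $*_2:\Omega^{pq}\to\Omega^{p,n-q}$ is the Hodge star on the form factor, defined in the same way for $\mathrm V^*$ with the inverse form $\eta^{-1}$ and the normalized top element corresponding to $\mathbf v$ under the identification of $\mathrm V$ with $\mathrm V^*$ by $\eta$. For $x\in\Omega^{pq}$: $2Ex=\theta x+(-1)^{p+q}x\theta$, $E'=*_1^{-1}E*_1$ (equivalently $2E'x=\theta x-(-1)^{p+q}x\theta$), $F'=*_2^{-1}E*_2$, $F=*_1^{-1}*_2^{-1}E*_2*_1$, $Hx=(p+q-n)x$, $H'x=(q-p)x$. These operators define an action of $\mathfrak{sl}_2\times\mathfrak{sl}_2$ on Clifford forms. The Ricci tensor is $r=FR\in\Omega^{11}$. *)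

(* Defs.v *)
From HB Require Import structures.
From mathcomp Require Import all_boot all_order all_algebra all_field.
From mathcomp Require Import all_classical all_reals all_analysis.
From mathcomp Require Export complex.

Set Implicit Arguments.
Unset Strict Implicit.
Unset Printing Implicit Defensive.

Import GRing.Theory Num.Theory numFieldNormedType.Exports.
Local Open Scope ring_scope.

Notation "{ 'rlinear' V -> W }" :=
  {linear V -> W | (real_complex _) \; *:%R}
  (at level 0, V at level 98, W at level 99) : type_scope.

(* Cl is the complexification of Cl(V, eta): the universal complex algebra
   generated by V with the relations v v' + v' v = 2 eta(v, v').             *)
Definition clifford_algebra (R : realType) (V : vectType R)
    (eta : {symmetric V}) (Cl : falgType R[i]) (iota : {rlinear V -> Cl}) : Prop :=
  (forall v w, iota v * iota w + iota w * iota v =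
               (2 * real_complex R (eta v w))%:A) /\
  (forall (B : algType R[i]) (f : {rlinear V -> B}),
     (forall v w, f v * f w + f w * f v = (2 * real_complex R (eta v w))%:A) ->
     (exists g : {lrmorphism Cl -> B}, forall v, g (iota v) = f v) /\
     (forall g g' : {lrmorphism Cl -> B},
        (forall v, g (iota v) = f v) -> (forall v, g' (iota v) = f v) ->
        g =1 g')).

(* v /\ a and v |- a for an element a of parity k. *)
Definition wedge_act (R : realType) (V : vectType R) (Cl : falgType R[i])
    (iota : V -> Cl) (k : nat) (v : V) (a : Cl) : Cl :=
  2^-1 *: (iota v * a + (-1) ^+ k *: (a * iota v)).

Definition contr_act (R : realType) (V : vectType R) (Cl : falgType R[i])
    (iota : V -> Cl) (k : nat) (v : V) (a : Cl) : Cl :=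
  2^-1 *: (iota v * a - (-1) ^+ k *: (a * iota v)).

(* (v_1 /\ ... /\ v_p) /\ 1, which has the parity of p. *)
Fixpoint wedges (R : realType) (V : vectType R) (Cl : falgType R[i])
    (iota : V -> Cl) (s : seq V) : Cl :=
  if s is v :: s' then wedge_act iota (size s') v (wedges iota s') else 1.

(* Cl^p(V): the image of the complexified Lambda^p(V) under x |-> x /\ 1. *)
Definition Clp (R : realType) (V : vectType R) (Cl : falgType R[i])
    (iota : V -> Cl) (p : nat) (a : Cl) : Prop :=
  exists (m : nat) (z : 'I_m -> R[i]) (s : 'I_m -> p.-tuple V),
    a = \sum_(k < m) z k *: wedges iota (s k).

(* The Hodge star normalized by vol; since it exchanges Cl^p and Cl^(n-p),
   the parity of star a is that of n - p when a is in Cl^p.                  *)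
Definition hodge_star (R : realType) (V : vectType R) (Cl : falgType R[i])
    (iota : V -> Cl) (vol : Cl) (star : 'End(Cl)) : Prop :=
  let n := \dim {:V} in
  [/\ lker star == 0%VS,
      star vol = 1,
      forall p a, (p <= n)%N -> Clp iota p a -> Clp iota (n - p) (star a)
    & forall p a v, (p <= n)%N -> Clp iota p a ->
        wedge_act iota (n - p) v (star a) = star (contr_act iota p v a)].

(* An A-valued exterior form at a point of R^n is given by its coefficients: x
   stands for the sum of the x I (x) dx^I, where dx^I = dx^i1 /\ ... /\ dx^iq
   for I = {i1 < ... < iq}.                                                  *)
Definition ext (n : nat) (A : Type) := {ffun {set 'I_n} -> A}.

(* dx^I /\ dx^J = shuffle_sign I J dx^(I :|: J) for disjoint I and J. *)
Definition shuffle_sign (K : pzRingType) (n : nat) (I J : {set 'I_n}) : K :=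
  (-1) ^+ #|[set ij : 'I_n * 'I_n | [&& ij.1 \in I, ij.2 \in J & ij.2 < ij.1]%N]|.

(* (a (x) alpha) (b (x) beta) = a b (x) alpha /\ beta *)
Definition ext_mul (K : fieldType) (n : nat) (A : algType K)
    (x y : ext n A) : ext n A :=
  [ffun L : {set 'I_n} => \sum_(I : {set 'I_n} | I \subset L)
     shuffle_sign K I (L :\: I) *: (x I * y (L :\: I))].

Definition ext_one (K : fieldType) (n : nat) (A : algType K) : ext n A :=
  [ffun I : {set 'I_n} => (I == finset.set0)%:R].

Definition ext_basis (K : fieldType) (n : nat) (I : {set 'I_n}) : ext n K^o :=
  [ffun J => (J == I)%:R].

(* The pullback of forms along a linear map given by its Jacobian matrix,
   L i j being the derivative of the j-th target coordinate along the i-th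
   source coordinate: dx^j is pulled back to the sum of L i j dx^i.          *)
Definition ext_pullback (R : realType) (n : nat) (Cl : falgType R[i])
    (L : 'M[R]_n) (x : ext n Cl) : ext n Cl :=
  let dx j : ext n R[i]^o :=
    \sum_(i < n) real_complex R (L i j) *: ext_basis R[i] [set i] in
  [ffun K => \sum_(J : {set 'I_n})
     (\big[@ext_mul _ n R[i]^o/ext_one n R[i]^o]_(j <- enum J) dx j) K *: x J].

(* i_X x for a 1-form x. *)
Definition eval1 (R : realType) (n : nat) (Cl : falgType R[i])
    (x : ext n Cl) (X : 'rV[R]_n) : Cl :=
  \sum_(i < n) real_complex R (X 0 i) *: x [set i].

Definition Omega_at (R : realType) (V : vectType R) (Cl : falgType R[i])
    (iota : V -> Cl) (n p q : nat) (x : ext n Cl) : Prop :=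
  forall I : {set 'I_n}, Clp iota p (x I) /\ (#|I| != q -> x I = 0).

Definition nondegenerate_at (R : realType) (V : vectType R) (Cl : falgType R[i])
    (iota : V -> Cl) (n : nat) (theta : ext n Cl) : Prop :=
  exists2 T : {linear 'rV[R]_n -> V}, bijective T &
    forall X, eval1 theta X = iota (T X).

(* The vector corresponding to dx^i when theta identifies the cotangent space
   with the dual V' of V and eta identifies V' with V.                       *)
Definition sharp (R : realType) (V : vectType R) (eta : V -> V -> R)
    (Cl : falgType R[i]) (iota : V -> Cl) (n : nat) (theta : ext n Cl)
    (i : 'I_n) : V :=
  xget 0 [set v : V | forall (X : 'rV[R]_n) (w : V),
                        iota w = eval1 theta X -> eta v w = X 0 i]%classic.

(* The isomorphism of Lambda(V'), i.e. of the exterior forms, with Cl(V). *)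
Definition symbol (R : realType) (V : vectType R) (eta : V -> V -> R)
    (Cl : falgType R[i]) (iota : V -> Cl) (n : nat) (theta : ext n Cl) :
    'Hom({ffun {set 'I_n} -> R[i]^o}, Cl) :=
  linfun (fun u : {ffun {set 'I_n} -> R[i]^o} => \sum_(I : {set 'I_n})
    u I *: wedges iota [seq sharp eta iota theta i | i <- enum I]).

Definition on_cliff (R : realType) (Cl : falgType R[i]) (n : nat)
    (f : 'End(Cl)) (x : ext n Cl) : ext n Cl := [ffun I : {set 'I_n} => f (x I)].

(* f acting on the form factor. As eta is an isometry of V with its dual V'
   carrying eta^-1, Cl(V) together with the map V' = V -> Cl(V) is a Clifford
   algebra of V', and the Hodge star of Lambda(V') for the top element
   corresponding to vol is the one of Cl(V), transported by symbol.          *)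
Definition on_form (R : realType) (V : vectType R) (eta : V -> V -> R)
    (Cl : falgType R[i]) (iota : V -> Cl) (n : nat) (theta : ext n Cl)
    (f : 'End(Cl)) (x : ext n Cl) : ext n Cl :=
  let J := symbol eta iota theta in
  [ffun K : {set 'I_n} => \sum_(I : {set 'I_n})
     ((J^-1)%VF (f (J (ext_basis R[i] I)))) K *: x I].

(* The operators on Omega^(p, q) at a point. *)
Definition E_at (R : realType) (Cl : falgType R[i]) (n : nat)
    (theta : ext n Cl) (p q : nat) (x : ext n Cl) : ext n Cl :=
  2^-1 *: (ext_mul theta x + (-1) ^+ (p + q) *: ext_mul x theta).

Definition E'_at (R : realType) (Cl : falgType R[i]) (star : 'End(Cl)) (n : nat)
    (theta : ext n Cl) (p q : nat) (x : ext n Cl) : ext n Cl :=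
  on_cliff (star^-1)%VF (E_at theta (n - p) q (on_cliff star x)).

Definition F'_at (R : realType) (V : vectType R) (eta : V -> V -> R)
    (Cl : falgType R[i]) (iota : V -> Cl) (star : 'End(Cl)) (n : nat)
    (theta : ext n Cl) (p q : nat) (x : ext n Cl) : ext n Cl :=
  let star2 := on_form eta iota theta in
  star2 (star^-1)%VF (E_at theta p (n - q) (star2 star x)).

Definition F_at (R : realType) (V : vectType R) (eta : V -> V -> R)
    (Cl : falgType R[i]) (iota : V -> Cl) (star : 'End(Cl)) (n : nat)
    (theta : ext n Cl) (p q : nat) (x : ext n Cl) : ext n Cl :=
  let star2 := on_form eta iota theta in
  on_cliff (star^-1)%VF (star2 (star^-1)%VF
    (E_at theta (n - p) (n - q) (star2 star (on_cliff star x)))).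

Definition H_at (R : realType) (Cl : falgType R[i]) (n p q : nat)
    (x : ext n Cl) : ext n Cl := (p%:R + q%:R - n%:R) *: x.

Definition H'_at (R : realType) (Cl : falgType R[i]) (n p q : nat)
    (x : ext n Cl) : ext n Cl := (q%:R - p%:R) *: x.

(* Cl (x) Cl is realized as square matrices, a (x) b being the matrix of products
   of coordinates; Omega^(2,2) thus takes values in Cl^2 (x) Cl^2 and the
   exchange of the two factors is transposition.                             *)
Definition tensor (R : realType) (Cl : falgType R[i]) (a b : Cl) :
    'M[R[i]]_(\dim {:Cl}) :=
  \matrix_(k, l) (coord (vbasis {:Cl}) k a * coord (vbasis {:Cl}) l b).

Definition symmetric_at (R : realType) (V : vectType R) (eta : V -> V -> R)
    (Cl : falgType R[i]) (iota : V -> Cl) (n : nat) (theta : ext n Cl)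
    (x : ext n Cl) : Prop :=
  let t := \sum_(I : {set 'I_n})
             tensor (x I) (symbol eta iota theta (ext_basis R[i] I)) in
  t^T = t.

Definition partial (R : realType) (n : nat) (i : 'I_n) (f : 'rV[R]_n -> R) :
  'rV[R]_n -> R := fun x => 'D_(delta_mx 0 i : 'rV[R]_n) f x.

Fixpoint Ck (R : realType) (n : nat) (k : nat) (U : set 'rV[R]_n)
    (f : 'rV[R]_n -> R) : Prop :=
  (forall x, U x -> {for x, continuous f}) /\
  (if k is k'.+1 then
     forall i : 'I_n,
       (forall x, U x -> derivable f x (delta_mx 0 i : 'rV[R]_n)) /\
       Ck k' U (partial i f)
   else True).

Definition smooth_on (R : realType) (n : nat) (U : set 'rV[R]_n)
    (f : 'rV[R]_n -> R) : Prop := forall k, Ck k U f.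

(* Cl-valued functions are differentiated coordinatewise. *)
Definition smooth_on_cliff (R : realType) (Cl : falgType R[i]) (n : nat)
    (U : set 'rV[R]_n) (f : 'rV[R]_n -> Cl) : Prop :=
  forall k, smooth_on U (fun x => complex.Re (coord (vbasis {:Cl}) k (f x))) /\
            smooth_on U (fun x => complex.Im (coord (vbasis {:Cl}) k (f x))).

Definition partial_cliff (R : realType) (Cl : falgType R[i]) (n : nat)
    (i : 'I_n) (f : 'rV[R]_n -> Cl) (x : 'rV[R]_n) : Cl :=
  \sum_(k < \dim {:Cl})
    Complex (partial i (fun y => complex.Re (coord (vbasis {:Cl}) k (f y))) x)
            (partial i (fun y => complex.Im (coord (vbasis {:Cl}) k (f y))) x)
    *: (vbasis {:Cl})`_k.

Record smooth_atlas (R : realType) (n : nat) (M : topologicalType) := SmoothAtlas {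
  chart : Type;
  chart_dom : chart -> set M;
  chart_map : chart -> M -> 'rV[R]_n;
  chart_inv : chart -> 'rV[R]_n -> M;
  chart_dom_open : forall c, open (chart_dom c);
  chart_img_open : forall c, open (chart_map c @` chart_dom c)%classic;
  chart_mapK : forall c, {in chart_dom c, cancel (chart_map c) (chart_inv c)};
  chart_map_continuous : forall c m, chart_dom c m ->
    {for m, continuous (chart_map c)};
  chart_inv_continuous : forall c m, chart_dom c m ->
    {for chart_map c m, continuous (chart_inv c)};
  chart_cover : forall m, exists c, chart_dom c m;
  chart_transition : forall c c' (j : 'I_n),
    smooth_on (chart_map c @` (chart_dom c `&` chart_dom c'))%classic
              (fun y => chart_map c' (chart_inv c y) 0 j)
}.

Definition chart_img (R : realType) (n : nat) (M : topologicalType)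
    (A : smooth_atlas R n M) (c : chart A) : set 'rV[R]_n :=
  (chart_map c @` chart_dom c)%classic.

Definition jacobian_matrix (R : realType) (n : nat) (M : topologicalType)
    (A : smooth_atlas R n M) (c c' : chart A) (y : 'rV[R]_n) : 'M[R]_n :=
  \matrix_(i, j) partial i (fun z => chart_map c' (chart_inv c z) 0 j) y.

(* A Cl-valued form on M is the family of its expressions in the charts; only
   the values of x c on the image of the chart c are meaningful.             *)
Definition mform (R : realType) (n : nat) (M : topologicalType)
  (A : smooth_atlas R n M) (Cl : Type) := chart A -> 'rV[R]_n -> ext n Cl.

Definition Omega (R : realType) (V : vectType R) (Cl : falgType R[i])
    (iota : V -> Cl) (n : nat) (M : topologicalType) (A : smooth_atlas R n M)
    (p q : nat) (x : mform A Cl) : Prop :=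
  [/\ forall c y, chart_img c y -> Omega_at iota p q (x c y),
      forall c (I : {set 'I_n}), smooth_on_cliff (chart_img c) (fun y => x c y I)
    & forall c c' y, (chart_map c @` (chart_dom c `&` chart_dom c'))%classic y ->
        x c y = ext_pullback (jacobian_matrix c c' y)
                             (x c' (chart_map c' (chart_inv c y)))].

Definition nondegenerate_form (R : realType) (V : vectType R)
    (Cl : falgType R[i]) (iota : V -> Cl) (n : nat) (M : topologicalType)
    (A : smooth_atlas R n M) (theta : mform A Cl) : Prop :=
  forall c y, chart_img c y -> nondegenerate_at iota (theta c y).

Definition feq (R : realType) (Cl : falgType R[i]) (n : nat)
    (M : topologicalType) (A : smooth_atlas R n M) (x y : mform A Cl) : Prop :=
  forall c z, chart_img c z -> x c z = y c z.

Definition fadd (R : realType) (Cl : falgType R[i]) (n : nat)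
    (M : topologicalType) (A : smooth_atlas R n M) (x y : mform A Cl) :
  mform A Cl := fun c z => x c z + y c z.

Definition fmul (R : realType) (Cl : falgType R[i]) (n : nat)
    (M : topologicalType) (A : smooth_atlas R n M) (x y : mform A Cl) :
  mform A Cl := fun c z => ext_mul (x c z) (y c z).

(* d (f dx^J) is the sum of the partial_i f dx^i /\ dx^J. *)
Definition fd (R : realType) (Cl : falgType R[i]) (n : nat)
    (M : topologicalType) (A : smooth_atlas R n M) (x : mform A Cl) :
    mform A Cl :=
  fun c z => [ffun K : {set 'I_n} => \sum_(i in K)
    shuffle_sign R[i] [set i] (K :\ i) *:
      partial_cliff i (fun y => x c y (K :\ i)) z].

Definition torsion (R : realType) (Cl : falgType R[i]) (n : nat)
    (M : topologicalType) (A : smooth_atlas R n M)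
    (theta omega : mform A Cl) : mform A Cl :=
  fadd (fd theta) (fadd (fmul omega theta) (fmul theta omega)).

Definition curvature (R : realType) (Cl : falgType R[i]) (n : nat)
    (M : topologicalType) (A : smooth_atlas R n M) (omega : mform A Cl) :
  mform A Cl := fadd (fd omega) (fmul omega omega).

Section GlobalOperators.
Context (R : realType) (V : vectType R) (eta : V -> V -> R).
Context (Cl : falgType R[i]) (iota : V -> Cl) (star : 'End(Cl)).
Context (n : nat) (M : topologicalType) (A : smooth_atlas R n M).
Context (theta : mform A Cl).
Implicit Types x : mform A Cl.

Definition star1 x : mform A Cl := fun c z => on_cliff star (x c z).
Definition star2 x : mform A Cl :=
  fun c z => on_form eta iota (theta c z) star (x c z).

Definition opE p q x : mform A Cl := fun c z => E_at (theta c z) p q (x c z).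
Definition opE' p q x : mform A Cl :=
  fun c z => E'_at star (theta c z) p q (x c z).
Definition opF p q x : mform A Cl :=
  fun c z => F_at eta iota star (theta c z) p q (x c z).
Definition opF' p q x : mform A Cl :=
  fun c z => F'_at eta iota star (theta c z) p q (x c z).
Definition opH p q x : mform A Cl := fun c z => H_at p q (x c z).
Definition opH' p q x : mform A Cl := fun c z => H'_at p q (x c z).

Definition vanishes x : Prop := forall c z, chart_img c z -> x c z = 0.

Definition sl2sl2_invariant p q x : Prop :=
  [/\ vanishes (opE p q x), vanishes (opF p q x) & vanishes (opH p q x)] /\
  [/\ vanishes (opE' p q x), vanishes (opF' p q x) & vanishes (opH' p q x)].

Definition pair_symmetric x : Prop :=
  forall c z, chart_img c z -> symmetric_at eta iota (theta c z) (x c z).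

Definition self_dual x : Prop := feq (star1 (star2 x)) x.

(* The component of x in the joint eigenspace of *_1 and *_2 for the eigenvalues
   (-1)^s and (-1)^t: false stands for + and true for -.                     *)
Definition eigenpart (s t : bool) x : mform A Cl := fun c z =>
  4^-1 *: (x c z + (-1) ^+ s *: star1 x c z + (-1) ^+ t *: star2 x c z
           + (-1) ^+ (s + t) *: star1 (star2 x) c z).

Definition fscale (a : R[i]) x : mform A Cl := fun c z => a *: x c z.

End GlobalOperators.

(* Main.v *)
Require Import Defs.
From HB Require Import structures.
From mathcomp Require Import all_boot all_order all_algebra all_field.
From mathcomp Require Import all_classical all_reals all_analysis.

Set Implicit Arguments.
Unset Strict Implicit.
Unset Printing Implicit Defensive.

Import GRing.Theory Num.Theory numFieldNormedType.Exports.
Local Open Scope ring_scope.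

(** Every assertion is an identity between the values of forms at one point.
    There a nondegenerate theta provides a basis xi_i of V together with its
    eta-dual basis sh_i, and a form x, the sum of the x_I dx^I, becomes the
    element sum_I x_I (x) sh_I of Cl (x) Cl ([symbol2]), where sh_I is the
    exterior monomial in the sh_i, i in I.  On bidegree (p, q) the operators
    E, E', F', F turn into the action of the tensor t = sum_i xi_i (x) sh_i by
    wedge (x) wedge, contraction (x) wedge, wedge (x) contraction and
    contraction (x) contraction ([symbol2_E], [symbol2_E'], [symbol2_F']).
    The tensor t is symmetric, being the inverse of the metric, so the exchange
    of the two factors carries E' to F'.

    The heart of the proof is that on Lambda^2 (x) Lambda^2 the exchange of the
    factors is 1 - F' E' + (F'^2 E'^2) / 4, the Weyl reflection of the sl_2
    spanned by E' and F' ([weyl_reflection]).  Consequently E' y = 0 forces y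
    to be symmetric, which is the classical passage from the first Bianchi
    identity to the pair symmetry of a curvature tensor, and then
    F' y = 0 because F' is E' conjugated by the exchange.  The roles of E' and
    F' being symmetric, E' y = 0 and F' y = 0 are equivalent for y of bidegree
    (2, 2), and each makes y symmetric ([E'0_iff_F'0]).

    On Cl^p the Hodge star is right multiplication by vol ([star_mul_vol]), so
    it is an involution, and conjugation by star_1 turns E' into E and F' into
    F.  Applied to y = star_1 R, the equivalence says that F R = 0 if and only
    if E R = 0, and that star_1 R is then symmetric; applied to y = R, it says
    that E' R = 0 if and only if F' R = 0, and that R is then symmetric.  This
    is the invariance, as H and H' vanish in bidegree (2, 2).  Finally, the
    exchange of the factors carries star_1 R to star_2 R when R is symmetric,
    hence star_1 R = star_2 R, which is self-duality.

    The curvature has bidegree (2, 2) since a derivative of a function with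
    values in Cl^2 has values in Cl^2 and the commutator of two elements of Cl^2
    is in Cl^2 ([curvature_Omega]). *)

(** * The grading involution, wedge and contraction *)

Section CliffordOperators.

Context (R : realType) (V : vectType R) (eta : {symmetric V}).
Context (Cl : falgType R[i]) (iota : {rlinear V -> Cl}).
Hypothesis Cl_clifford : clifford_algebra eta iota.

Lemma clifford_anticomm v w :
  iota v * iota w + iota w * iota v = (2 * real_complex R (eta v w))%:A.
Proof. by case: Cl_clifford. Qed.

(** The relations are even, so v |-> - v extends to an endomorphism of Cl; its
    square fixes V, hence is the identity by the uniqueness part of the
    universal property. *)
Lemma grading_exists : exists al : {lrmorphism Cl -> Cl},
  (forall v, al (iota v) = - iota v) /\ involutive al.
Proof.
have [rel univ] := Cl_clifford.
pose niota : V -> Cl := fun v => - iota v.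
have niota_lin : linear_for (real_complex R \; *:%R) niota.
  by move=> a u v; rewrite /niota linearP /= opprD scalerN.
pose niotaL := GRing.isLinear.Build R V Cl (real_complex R \; *:%R) niota niota_lin.
pose f : {rlinear V -> Cl} := HB.pack niota niotaL.
have frel v w : f v * f w + f w * f v = (2 * real_complex R (eta v w))%:A.
  by rewrite /f /= /niota !mulrNN rel.
have [[al al_iota] _] := univ Cl f frel.
exists al; split=> [v|a]; first exact: al_iota.
have [_ uniq_id] := univ Cl iota rel.
apply: (uniq_id (al \o al : {lrmorphism Cl -> Cl}) (idfun : {lrmorphism Cl -> Cl})) => //= v.
by rewrite al_iota /f /= /niota linearN /= -/(niota v) al_iota opprK.
Qed.

End CliffordOperators.

Section Creation.

Context (R : realType) (V : vectType R) (eta : {symmetric V}).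
Context (Cl : falgType R[i]) (iota : {rlinear V -> Cl}).
Hypothesis Cl_clifford : clifford_algebra eta iota.
Context (al : {lrmorphism Cl -> Cl}).
Hypothesis al_iota : forall v, al (iota v) = - iota v.
Hypothesis alK : involutive al.

(** With the grading involution in place of the sign (-1) ^+ k, the two actions
    become linear operators on the whole algebra, and no parity needs to be
    tracked.  They agree with [wedge_act] and [contr_act] on each Cl^k. *)
Definition cwedge (v : V) (a : Cl) : Cl := 2^-1 *: (iota v * a + al a * iota v).
Definition ccontr (v : V) (a : Cl) : Cl := 2^-1 *: (iota v * a - al a * iota v).

Lemma cwedge_is_linear v : linear (cwedge v).
Proof.
move=> z a b; rewrite /cwedge linearP /= mulrDl mulrDr -scalerAl -scalerAr.
by rewrite addrACA -[z *: _ + z *: _]scalerDr [LHS]scalerDr !scalerA [2^-1 * z]mulrC.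
Qed.

Lemma ccontr_is_linear v : linear (ccontr v).
Proof.
move=> z a b; rewrite /ccontr linearP /= mulrDl mulrDr -scalerAl -scalerAr.
by rewrite opprD addrACA -[z *: _ - z *: _]scalerBr [LHS]scalerDr !scalerA [2^-1 * z]mulrC.
Qed.

HB.instance Definition _ v :=
  GRing.isLinear.Build R[i] Cl Cl _ (cwedge v) (cwedge_is_linear v).
HB.instance Definition _ v :=
  GRing.isLinear.Build R[i] Cl Cl _ (ccontr v) (ccontr_is_linear v).

Lemma cwedgeZ v z a : cwedge v (z *: a) = z *: cwedge v a.
Proof. exact: linearZ. Qed.

Lemma ccontrZ v z a : ccontr v (z *: a) = z *: ccontr v a.
Proof. exact: linearZ. Qed.

Lemma cwedge_suml n (z : 'I_n -> R) (e : 'I_n -> V) a :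
  cwedge (\sum_i z i *: e i) a = \sum_i real_complex R (z i) *: cwedge (e i) a.
Proof.
rewrite /cwedge linear_sum /= mulr_suml mulr_sumr -big_split scaler_sumr /=.
apply: eq_bigr => i _; rewrite linearZ /= -scalerAl -scalerAr -scalerDr.
by rewrite !scalerA mulrC.
Qed.

Lemma ccontr_suml n (z : 'I_n -> R) (e : 'I_n -> V) a :
  ccontr (\sum_i z i *: e i) a = \sum_i real_complex R (z i) *: ccontr (e i) a.
Proof.
rewrite /ccontr linear_sum /= mulr_suml mulr_sumr -sumrB scaler_sumr /=.
apply: eq_bigr => i _; rewrite linearZ /= -scalerAl -scalerAr -scalerBr.
by rewrite !scalerA mulrC.
Qed.

Lemma al_cwedge v a : al (cwedge v a) = - cwedge v (al a).
Proof.
by rewrite /cwedge linearZ /= linearD /= !rmorphM /= al_iota mulNr mulrN -opprD scalerN.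
Qed.

Lemma al_ccontr v a : al (ccontr v a) = - ccontr v (al a).
Proof.
rewrite /ccontr linearZ /= linearB /= !rmorphM /= al_iota mulNr mulrN -scalerN.
by rewrite opprB opprK addrC.
Qed.

Lemma ccontr1 v : ccontr v 1 = 0.
Proof. by rewrite /ccontr rmorph1 mulr1 mul1r subrr scaler0. Qed.

(** The expansions below are compared in [cwedgeC] and [ccontr_cwedge], where the
    symmetric part in v and w of each of them is a scalar by the Clifford
    relation. *)
Lemma cwedge_cwedgeE v w a : cwedge v (cwedge w a) =
  4^-1 *: (iota v * iota w * a - a * iota w * iota v +
           (iota v * al a * iota w - iota w * al a * iota v)).
Proof.
rewrite [cwedge v _]/cwedge al_cwedge /cwedge alK -scalerAr -scalerN -scalerAl.
rewrite -scalerDr scalerA -invfM -natrM opprD mulrDr mulrDl !mulNr !mulrA.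
by rewrite [- _ - _]addrC addrACA.
Qed.

Lemma ccontr_cwedgeE v w a : ccontr v (cwedge w a) =
  4^-1 *: (iota v * iota w * a + a * iota w * iota v +
           (iota v * al a * iota w + iota w * al a * iota v)).
Proof.
rewrite [ccontr v _]/ccontr al_cwedge /cwedge alK -scalerAr -scalerN -scalerAl.
rewrite -scalerBr scalerA -invfM -natrM opprD mulrDr mulrDl !mulNr !mulrA.
by rewrite opprD !opprK [X in _ + X]addrC addrACA.
Qed.

Lemma cwedge_ccontrE v w a : cwedge w (ccontr v a) =
  4^-1 *: (iota w * iota v * a + a * iota v * iota w -
           (iota v * al a * iota w + iota w * al a * iota v)).
Proof.
rewrite [cwedge w _]/cwedge al_ccontr /ccontr alK -scalerAr -scalerN -scalerAl.
rewrite -scalerDr scalerA -invfM -natrM opprB mulrBr mulrBl !mulrA.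
by rewrite addrACA -opprD [X in _ - X]addrC.
Qed.

Lemma cwedgeC v w a : cwedge v (cwedge w a) = - cwedge w (cwedge v a).
Proof.
apply/eqP; rewrite -addr_eq0 !cwedge_cwedgeE -scalerDr addrACA.
rewrite [X in _ + X]addrA subrK subrr addr0 addrACA -opprD -mulrDl.
rewrite -!mulrA -mulrDr [iota w * iota v + _]addrC.
rewrite (clifford_anticomm Cl_clifford) -scalerAl -scalerAr mulr1 mul1r.
by rewrite subrr scaler0.
Qed.

Lemma cwedge_cwedge0 v a : cwedge v (cwedge v a) = 0.
Proof.
have /eqP := cwedgeC v v a.
by rewrite -addr_eq0 -mulr2n -scaler_nat scaler_eq0 pnatr_eq0 => /eqP.
Qed.

(** Wedge and contraction satisfy the canonical anticommutation relations of
    creation and annihilation operators, with 1 as the vacuum ([ccontr1]). *)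
Lemma ccontr_cwedge v w a :
  ccontr v (cwedge w a) = real_complex R (eta v w) *: a - cwedge w (ccontr v a).
Proof.
apply/eqP; rewrite -subr_eq opprK ccontr_cwedgeE cwedge_ccontrE -scalerDr.
rewrite addrACA subrr addr0 addrACA -mulrDl -!mulrA -mulrDr.
rewrite [iota w * iota v + _]addrC (clifford_anticomm Cl_clifford).
rewrite -scalerAl -scalerAr mulr1 mul1r -scalerDl scalerA -mulrDl mulrA.
rewrite -[2 + 2](natrD _ 2 2) mulVf ?mul1r ?pnatr_eq0 //.
Qed.

Lemma wedge_actE k v a : al a = (-1) ^+ k *: a -> wedge_act iota k v a = cwedge v a.
Proof. by move=> ka; rewrite /wedge_act /cwedge ka scalerAl. Qed.

Lemma contr_actE k v a : al a = (-1) ^+ k *: a -> contr_act iota k v a = ccontr v a.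
Proof. by move=> ka; rewrite /contr_act /ccontr ka scalerAl. Qed.

Lemma al_wedges s : al (wedges iota s) = (-1) ^+ size s *: wedges iota s.
Proof.
elim: s => [|v s IHs] /=; first by rewrite rmorph1 scale1r.
by rewrite wedge_actE // al_cwedge IHs cwedgeZ exprS mulN1r scaleNr.
Qed.

Lemma wedges_cons v s : wedges iota (v :: s) = cwedge v (wedges iota s).
Proof. by rewrite /= wedge_actE // al_wedges. Qed.

End Creation.

(* Unification must see these operators as atoms and not as multiples of the
   scalar 2^-1. *)
#[global] Opaque cwedge ccontr.

(** * The subspaces Cl^p *)

Section GradedPieces.

Context (R : realType) (V : vectType R) (eta : {symmetric V}).
Context (Cl : falgType R[i]) (iota : {rlinear V -> Cl}).
Hypothesis Cl_clifford : clifford_algebra eta iota.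
Context (al : {lrmorphism Cl -> Cl}).
Hypothesis al_iota : forall v, al (iota v) = - iota v.
Hypothesis alK : involutive al.

Local Notation cwedge := (cwedge iota al).
Local Notation ccontr := (ccontr iota al).

Lemma Clp_wedges s : Clp iota (size s) (wedges iota s).
Proof.
exists 1%N, (fun=> 1), (fun=> in_tuple s).
by rewrite big_ord1 scale1r.
Qed.

Lemma Clp0 p : Clp iota p 0.
Proof.
by exists 0%N, (fun=> 0), (fun=> nseq_tuple p 0); rewrite big_ord0.
Qed.

Lemma ClpZ p z a : Clp iota p a -> Clp iota p (z *: a).
Proof.
case=> m [u [s ->]]; exists m, (fun k => z * u k), s.
by rewrite scaler_sumr; apply: eq_bigr => k _; rewrite scalerA.
Qed.

Lemma ClpD p a b : Clp iota p a -> Clp iota p b -> Clp iota p (a + b).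
Proof.
case=> m [u [s ->]] [m' [u' [s' ->]]].
exists (m + m')%N, (fun k => match fintype.split k with inl i => u i | inr j => u' j end).
exists (fun k => match fintype.split k with inl i => s i | inr j => s' j end).
rewrite big_split_ord /=; congr (_ + _); apply: eq_bigr => k _.
  by rewrite (unsplitK (inl k)).
by rewrite (unsplitK (inr k)).
Qed.

Lemma ClpN p a : Clp iota p a -> Clp iota p (- a).
Proof. by rewrite -scaleN1r; apply: ClpZ. Qed.

Lemma Clp_sum p (T : Type) (r : seq T) (P : pred T) (F : T -> Cl) :
  (forall i, P i -> Clp iota p (F i)) -> Clp iota p (\sum_(i <- r | P i) F i).
Proof.
by move=> HF; apply: big_ind => //; [exact: Clp0 | move=> *; exact: ClpD].
Qed.

Lemma Clp_ind p (P : Cl -> Prop) : P 0 ->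
  (forall z a b, P a -> P b -> P (z *: a + b)) ->
  (forall s, size s = p -> P (wedges iota s)) ->
  forall a, Clp iota p a -> P a.
Proof.
move=> P0 Plin Pw _ [m [z [s ->]]].
elim/big_rec: _ => // k a _ Pa; apply: Plin => //.
by apply: Pw; rewrite size_tuple.
Qed.

Lemma al_Clp p a : Clp iota p a -> al a = (-1) ^+ p *: a.
Proof.
elim/Clp_ind: a / => [|z a b IHa IHb|s <-]; first by rewrite linear0 scaler0.
  by rewrite (linearP al) /= IHa IHb scalerDr !scalerA mulrC.
exact: (al_wedges al_iota).
Qed.

Lemma wedge_act_Clp p v a : Clp iota p a -> wedge_act iota p v a = cwedge v a.
Proof. by move=> /al_Clp /wedge_actE ->. Qed.

Lemma contr_act_Clp p v a : Clp iota p a -> contr_act iota p v a = ccontr v a.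
Proof. by move=> /al_Clp /contr_actE ->. Qed.

Lemma Clp_cwedge p v a : Clp iota p a -> Clp iota p.+1 (cwedge v a).
Proof.
elim/Clp_ind: a / => [|z a b IHa IHb|s <-]; first by rewrite (linear0 (cwedge v)); exact: Clp0.
  by rewrite (linearP (cwedge v)); apply: ClpD => //; apply: ClpZ.
by rewrite -(wedges_cons al_iota); exact: (Clp_wedges (v :: s)).
Qed.

Lemma Clp_ccontr p v a : Clp iota p a -> Clp iota p.-1 (ccontr v a).
Proof.
elim/Clp_ind: a / => [|z a b IHa IHb|s <-]; first by rewrite (linear0 (ccontr v)); exact: Clp0.
  by rewrite (linearP (ccontr v)); apply: ClpD => //; apply: ClpZ.
elim: s => [|w s IHs]; first by rewrite ccontr1; exact: Clp0.
rewrite (wedges_cons al_iota) (ccontr_cwedge Cl_clifford al_iota alK).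
apply: ClpD; first by apply: ClpZ; exact: Clp_wedges.
apply: ClpN; case: s IHs => [|w' s] IHs; last exact: Clp_cwedge.
by rewrite ccontr1 (linear0 (cwedge w)); exact: Clp0.
Qed.

End GradedPieces.

(** * Signs of shuffles *)

Lemma shuffle_sign1 (K : pzRingType) (n : nat) (j : 'I_n) (I : {set 'I_n}) :
  shuffle_sign K [set j] I = (-1) ^+ count (fun k : 'I_n => (k < j)%N) (enum I).
Proof.
rewrite /shuffle_sign; congr (_ ^+ _).
rewrite -size_filter -(size_map (pair j)) -(card_uniqP _); last first.
  by rewrite map_inj_uniq; [exact/filter_uniq/enum_uniq | move=> x y []].
apply: eq_card => -[a b]; rewrite !inE /=.
apply/and3P/mapP => [[/eqP -> bI ltba]|[k]].
  by exists b => //; rewrite mem_filter ltba mem_enum.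
by rewrite mem_filter mem_enum => /andP [ltk kI] [-> ->]; rewrite eqxx.
Qed.

Lemma shuffle_sign_sqr (K : pzRingType) (n : nat) (I J : {set 'I_n}) :
  shuffle_sign K I J * shuffle_sign K I J = 1.
Proof. by rewrite /shuffle_sign -expr2 sqrr_sign. Qed.

(** An increasing enumeration acquires j right after the elements below j; this
    is what makes [shuffle_sign] the sign of inserting a factor into an exterior
    monomial. *)
Lemma enum_setU1 (n : nat) (j : 'I_n) (I : {set 'I_n}) : j \notin I ->
  exists s1 s2, [/\ enum I = s1 ++ s2, enum (j |: I) = s1 ++ j :: s2
    & size s1 = count (fun k : 'I_n => (k < j)%N) (enum I)].
Proof.
move=> jI; pose lt : rel 'I_n := fun a b => (a < b)%N.
have lt_tr : transitive lt by move=> a b c; exact: ltn_trans.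
have lt_irr : irreflexive lt by move=> a; exact: ltnn.
have enum_lt (A : {set 'I_n}) : pairwise lt (enum A).
  rewrite -sorted_pairwise // /enum_mem -enumT /=.
  apply: sorted_filter => //.
  by have := iota_ltn_sorted 0 n; rewrite -val_enum_ord sorted_map.
pose s1 := [seq k <- enum I | lt k j]; pose s2 := [seq k <- enum I | lt j k].
have s1I k : (k \in s1) = (lt k j) && (k \in I) by rewrite mem_filter mem_enum.
have s2I k : (k \in s2) = (lt j k) && (k \in I) by rewrite mem_filter mem_enum.
have all12 : allrel lt s1 s2.
  apply/allrelP => a b; rewrite s1I s2I => /andP [aj _] /andP [jb _].
  exact: lt_tr aj jb.
have pw1 : pairwise lt s1 by apply: subseq_pairwise (enum_lt I); exact: filter_subseq.
have pw2 : pairwise lt s2 by apply: subseq_pairwise (enum_lt I); exact: filter_subseq.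
exists s1, s2; split; last by rewrite size_filter.
  apply: (@irr_sorted_eq _ lt) => //; rewrite ?sorted_pairwise ?enum_lt //.
    by rewrite pairwise_cat all12 pw1 pw2.
  move=> k; rewrite mem_cat s1I s2I mem_enum -andb_orl /lt -neq_ltn.
  by case: eqVneq => [/val_inj ->|]; [rewrite (negPf jI)|].
apply: (@irr_sorted_eq _ lt) => //; rewrite ?sorted_pairwise ?enum_lt //.
  rewrite pairwise_cat /= pw1 pw2 allrel_consr all12 !andbT.
  by apply/andP; split; apply/allP => k; rewrite ?s1I ?s2I => /andP [].
move=> k; rewrite mem_cat in_cons s1I s2I mem_enum !inE orbCA -andb_orl /lt -neq_ltn.
by rewrite -val_eqE; case: (val k == val j).
Qed.

Lemma shuffle_sign_r1 (K : pzRingType) (n : nat) (I : {set 'I_n}) (i : 'I_n) :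
  i \notin I -> shuffle_sign K I [set i] = (-1) ^+ #|I| * shuffle_sign K [set i] I.
Proof.
move=> iI; rewrite shuffle_sign1 cardE.
rewrite -[size _](count_predC (fun k : 'I_n => (k < i)%N)) -exprD.
rewrite addnAC addnn -muln2 exprD exprM sqrr_sign mul1r /shuffle_sign; congr (_ ^+ _).
rewrite -size_filter -(size_map (pair^~ i)) -(card_uniqP _); last first.
  by rewrite map_inj_uniq; [exact/filter_uniq/enum_uniq | move=> x y []].
apply: eq_card => -[a b]; rewrite !inE /=.
apply/and3P/mapP => [[aI /eqP -> ltia]|[k]].
  by exists a => //; rewrite mem_filter mem_enum aI /= -leqNgt ltnW.
rewrite mem_filter mem_enum /= -leqNgt leq_eqVlt => /andP [/orP [/eqP ik|lt] kI] [-> ->].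
  by move: iI; rewrite (val_inj ik) kI.
by rewrite kI eqxx lt.
Qed.

Lemma sum_subset1 (n : nat) (A : nmodType) (F : {set 'I_n} -> A) (K : {set 'I_n}) :
  (forall I : {set 'I_n}, I \subset K -> #|I| != 1%N -> F I = 0) ->
  \sum_(I : {set 'I_n} | I \subset K) F I = \sum_(i in K) F [set i].
Proof.
move=> F0; rewrite (bigID (fun I : {set 'I_n} => #|I| == 1%N)) /=.
rewrite [X in _ + X]big1 ?addr0 => [|I /andP [IK I1]]; last exact: F0.
rewrite -(big_imset _ (h := fun i : 'I_n => [set i]) (A := mem K)) /=; last first.
  by move=> i j _ _; exact: finset.set1_inj.
apply: eq_bigl => I; apply/andP/imsetP => [[IK /cards1P [i Ii]]|[i iK ->]].
  by exists i => //; move: IK; rewrite Ii finset.sub1set.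
by rewrite finset.sub1set cards1.
Qed.

(** * The exterior algebra of a basis *)

Section Coframe.

Context (R : realType) (V : vectType R) (eta : {symmetric V}).
Context (Cl : falgType R[i]) (iota : {rlinear V -> Cl}).
Hypothesis Cl_clifford : clifford_algebra eta iota.
Context (al : {lrmorphism Cl -> Cl}).
Hypothesis al_iota : forall v, al (iota v) = - iota v.
Hypothesis alK : involutive al.
Context (n : nat) (xi sh : 'I_n -> V).
Hypothesis eta_xi_sh : forall i j, eta (xi i) (sh j) = (i == j)%:R.
Hypothesis sh_expand : forall v, v = \sum_i eta (xi i) v *: sh i.

Local Notation cwedge := (cwedge iota al).
Local Notation ccontr := (ccontr iota al).
Local Notation w s := (wedges iota [seq sh i | i <- s]).
Local Notation wI I := (w (enum I)).

Lemma w_cons j s : w (j :: s) = cwedge (sh j) (w s).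
Proof. exact: (wedges_cons al_iota). Qed.

Lemma cwedge_w_cat j s1 s2 :
  cwedge (sh j) (w (s1 ++ s2)) = (-1) ^+ size s1 *: w (s1 ++ j :: s2).
Proof.
elim: s1 => [|i s1 IHs]; first by rewrite scale1r w_cons.
rewrite !cat_cons !w_cons (cwedgeC Cl_clifford al_iota alK) IHs.
by rewrite cwedgeZ -scaleNr /= exprS mulN1r.
Qed.

Lemma cwedge_w_mem j s : j \in s -> cwedge (sh j) (w s) = 0.
Proof.
elim: s => // i s IHs; rewrite in_cons w_cons.
have [->|_ /=] := eqVneq j i => [_|/IHs js].
  exact: (cwedge_cwedge0 Cl_clifford).
by rewrite (cwedgeC Cl_clifford) // js linear0 oppr0.
Qed.

Lemma cwedge_wI j (I : {set 'I_n}) : cwedge (sh j) (wI I) =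
  if j \in I then 0 else shuffle_sign R[i] [set j] I *: wI (j |: I).
Proof.
case: ifPn => jI; first by rewrite cwedge_w_mem ?mem_enum.
have [s1 [s2 [E1 E2 sz]]] := enum_setU1 jI.
by rewrite shuffle_sign1 -sz E1 E2 cwedge_w_cat.
Qed.

Lemma ccontr_w_notin j s : j \notin s -> ccontr (xi j) (w s) = 0.
Proof.
elim: s => [_|i s IHs]; first exact: ccontr1.
rewrite in_cons negb_or => /andP [ji /IHs js].
rewrite w_cons (ccontr_cwedge Cl_clifford al_iota alK) eta_xi_sh (negPf ji) js.
by rewrite linear0 subr0 scale0r.
Qed.

(** Contracting with the xi i, from the first index on, leads back to 1. *)
Lemma w_neq0 s : uniq s -> w s != 0.
Proof.
elim: s => [_|i s IHs]; first exact: oner_neq0.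
rewrite cons_uniq w_cons => /andP [iNs /IHs].
apply: contra_neq => ws0; have C0 := ccontr_w_notin iNs.
have := ccontr_cwedge Cl_clifford al_iota alK (xi i) (sh i) (w s).
rewrite ws0 linear0 eta_xi_sh eqxx scale1r.
by rewrite C0 linear0 subr0 => <-.
Qed.

(** Wedge after contraction is the occupation number of the index j.  The
    exterior monomials are joint eigenvectors of these operators for pairwise
    distinct families of eigenvalues. *)
Lemma cwedge_ccontr_wI j (I : {set 'I_n}) :
  cwedge (sh j) (ccontr (xi j) (wI I)) = (j \in I)%:R *: wI I.
Proof.
case: (boolP (j \in I)) => jI; last first.
  by rewrite ccontr_w_notin ?mem_enum // linear0 scale0r.
have jI' : j \notin I :\ j by rewrite !inE eqxx.
have := cwedge_wI j (I :\ j); rewrite (negPf jI') finset.setD1K // => wE.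
have -> : wI I = shuffle_sign R[i] [set j] (I :\ j) *: cwedge (sh j) (wI (I :\ j)).
  by rewrite wE scalerA shuffle_sign_sqr scale1r.
rewrite scale1r ccontrZ cwedgeZ; congr (_ *: _).
rewrite (ccontr_cwedge Cl_clifford al_iota alK) eta_xi_sh eqxx scale1r.
by rewrite ccontr_w_notin ?mem_enum // linear0 subr0.
Qed.

(** The product over j of the occupation numbers for j in J, and of their
    complements for j outside J, is the projection to the monomial of J; such
    projections prove that the monomials are linearly independent. *)
Lemma coframe_projector (J : {set 'I_n}) : exists P : {linear Cl -> Cl},
  forall I : {set 'I_n}, P (wI I) = (I == J)%:R *: wI I.
Proof.
suff [P HP] : exists P : {linear Cl -> Cl}, forall I : {set 'I_n}, P (wI I) =
    (all (fun j => (j \in I) == (j \in J)) (enum 'I_n))%:R *: wI I.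
  exists P => I; rewrite HP; congr (_%:R *: _); congr nat_of_bool.
  apply/allP/eqP => [IJ|-> //]; apply/setP => j.
  by apply/eqP/IJ; rewrite mem_enum.
elim: (enum _) => [|j s [P HP]].
  by exists (idfun : {linear Cl -> Cl}) => I; rewrite /= scale1r.
pose N : {linear Cl -> Cl} := cwedge (sh j) \o ccontr (xi j).
case: (boolP (j \in J)) => jJ.
  exists (N \o P : {linear Cl -> Cl}) => I /=.
  by rewrite HP ccontrZ cwedgeZ cwedge_ccontr_wI scalerA -natrM mulnb jJ eqb_id andbC.
pose N' : {linear Cl -> Cl} := ccontr (xi j) \o cwedge (sh j).
exists (N' \o P : {linear Cl -> Cl}) => I /=.
rewrite HP cwedgeZ ccontrZ (ccontr_cwedge Cl_clifford) // cwedge_ccontr_wI.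
rewrite eta_xi_sh eqxx -scalerBl scalerA (negPf jJ).
by congr (_ *: _); case: (j \in I); rewrite ?subrr ?mulr0 // subr0 mulr1.
Qed.

(** Wedging with any v is a combination of wedges with the sh i, and these map
    monomials to multiples of monomials. *)
Lemma Clp_ind_coframe p (P : Cl -> Prop) : P 0 ->
  (forall z a b, P a -> P b -> P (z *: a + b)) ->
  (forall I : {set 'I_n}, #|I| = p -> P (wI I)) ->
  forall a, Clp iota p a -> P a.
Proof.
move=> P0 Plin PI; apply: Clp_ind => // s szs.
elim: s p szs P P0 Plin PI => [|v s IHs] p <- P P0 Plin PI.
  by have := PI finset.set0 (cards0 _); rewrite enum_set0.
rewrite (wedges_cons al_iota).
apply: (IHs _ erefl (fun a => P (cwedge v a))) => [|z a b|I cI].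
- by rewrite linear0.
- by rewrite (linearP (cwedge v)); exact: Plin.
rewrite [v]sh_expand cwedge_suml.
elim/big_rec: _ => // i a _ Pa; apply: (Plin) => //.
rewrite cwedge_wI; case: ifPn => // iI.
rewrite -[_ *: _]addr0; apply: Plin => //.
by apply: PI; rewrite cardsU1 iI cI.
Qed.

(** A subset of 'I_n has at most n elements, so there are no monomials of degree
    n + 1. *)
Lemma Clp_top_cwedge a v : Clp iota n a -> cwedge v a = 0.
Proof.
move=> /(Clp_cwedge al_iota v); elim/Clp_ind_coframe: (cwedge v a) / => //.
  by move=> z b c -> ->; rewrite scaler0 addr0.
by move=> I cI; have := max_card (mem I); rewrite cI card_ord ltnn.
Qed.

Lemma Clp_top_line a : Clp iota n a -> exists z, a = z *: wI (finset.setTfor 'I_n).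
Proof.
elim/Clp_ind_coframe: a / => [|z a b [u ->] [u' ->]|I cI].
- by exists 0; rewrite scale0r.
- by exists (z * u + u'); rewrite scalerDl scalerA.
suff -> : I = finset.setTfor 'I_n by exists 1; rewrite scale1r.
by apply/eqP; rewrite finset.eqEcard finset.subsetT cardsT card_ord cI leqnn.
Qed.

End Coframe.

(** * The Hodge star *)

Section HodgeStar.

Context (R : realType) (V : vectType R) (eta : {symmetric V}).
Context (Cl : falgType R[i]) (iota : {rlinear V -> Cl}).
Hypothesis Cl_clifford : clifford_algebra eta iota.
Context (al : {lrmorphism Cl -> Cl}).
Hypothesis al_iota : forall v, al (iota v) = - iota v.
Hypothesis alK : involutive al.
Context (n : nat) (xi sh : 'I_n -> V).
Hypothesis eta_xi_sh : forall i j, eta (xi i) (sh j) = (i == j)%:R.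
Hypothesis sh_expand : forall v, v = \sum_i eta (xi i) v *: sh i.
Hypothesis dimV : \dim {:V} = n.
Hypothesis n_even : ~~ odd n.
Context (vol : Cl) (vol_top : Clp iota n vol) (vol_sqr : vol * vol = 1).
Context (star : 'End(Cl)) (star_hodge : hodge_star iota vol star).

Local Notation cwedge := (cwedge iota al).
Local Notation ccontr := (ccontr iota al).
Local Notation w s := (wedges iota [seq sh i | i <- s]).
Local Notation wI I := (w (enum I)).

(** v /\ vol has degree n + 1, hence vanishes; for n even it is half the
    anticommutator of v and vol. *)
Lemma vol_anticomm v : vol * iota v = - (iota v * vol).
Proof.
have := wedge_act_Clp al_iota v vol_top.
rewrite (Clp_top_cwedge Cl_clifford al_iota alK sh_expand) // /wedge_act.
rewrite -signr_odd (negPf n_even) expr0 scale1r => /eqP.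
rewrite scaler_eq0 invr_eq0 pnatr_eq0 /= addrC addr_eq0.
by move=> /eqP.
Qed.

Lemma star_Clp p a : (p <= n)%N -> Clp iota p a -> Clp iota (n - p) (star a).
Proof. by case: star_hodge => _ _ + _; rewrite dimV; apply. Qed.

Lemma star_contr_act p a v : (p <= n)%N -> Clp iota p a ->
  wedge_act iota (n - p) v (star a) = star (contr_act iota p v a).
Proof. by case: star_hodge => _ _ _; rewrite dimV; apply. Qed.

(** Descending induction on p.  In degree n both sides are linear on the line
    spanned by vol, where star vol = 1 = vol * vol.  In lower degree every
    monomial is the contraction of a monomial b of degree p + 1, and the defining
    property of the star expresses the value on it through star b = b * vol,
    where moving a vector across vol turns wedge into contraction. *)
Lemma star_mul_vol p a : (p <= n)%N -> Clp iota p a -> star a = a * vol.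
Proof.
move=> /subnK; move: (n - p)%N => m; elim: m p a => [|m IHm] p a.
  rewrite add0n => -> /(Clp_top_line Cl_clifford al_iota alK sh_expand) [z ->].
  have [u vE] := Clp_top_line Cl_clifford al_iota alK sh_expand vol_top.
  have u0 : u != 0.
    by apply: contra_eq_neq vol_sqr => u0; rewrite vE u0 scale0r mul0r eq_sym oner_eq0.
  have -> : z *: wI (finset.setTfor 'I_n) = (z / u) *: vol.
    by rewrite [in RHS]vE scalerA divfK.
  by case: star_hodge => _ star1 _ _; rewrite linearZ /= star1 -scalerAl vol_sqr.
move=> pm; have ltpn : (p < n)%N by rewrite -pm addSnnS leq_addl.
elim/(Clp_ind_coframe Cl_clifford al_iota alK sh_expand): a /.
- by rewrite linear0 mul0r.
- by move=> z a b Ha Hb; rewrite linearP /= Ha Hb mulrDl scalerAl.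
move=> I cI.
(* As p < n, some index j is missing from I, and w_I is recovered from its
   wedge with sh j by contraction with xi j. *)
have /existsP [j jI] : [exists j, j \notin I].
  rewrite -negb_forall; apply: contraL ltpn => /forallP IT.
  rewrite -leqNgt -cI -[X in (X <= _)%N]card_ord.
  by apply: subset_leq_card; apply/fintype.subsetP => j _; exact: IT.
set b := cwedge (sh j) (wI I).
have wp : Clp iota p (wI I).
  by rewrite -cI cardE -(size_map sh); exact: Clp_wedges.
have bp : Clp iota p.+1 b by exact: Clp_cwedge.
have wE : wI I = contr_act iota p.+1 (xi j) b.
  rewrite (contr_act_Clp al_iota) // (ccontr_cwedge Cl_clifford) // eta_xi_sh eqxx.
  rewrite scale1r (ccontr_w_notin Cl_clifford al_iota alK eta_xi_sh) ?mem_enum //.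
  by rewrite linear0 subr0.
rewrite wE -star_contr_act // (IHm p.+1) ?addnS -?addSn //.
move: b {wE} bp => b bp.
rewrite /wedge_act /contr_act -[RHS]scalerAl mulrBl -scalerAl -!mulrA vol_anticomm.
rewrite mulrN scalerN; congr (_ *: (_ - _ *: _)).
have: odd (n - p.+1) = odd p.+1 by rewrite oddB // (negPf n_even).
by rewrite -signr_odd => ->; rewrite signr_odd.
Qed.

Lemma starK p a : (p <= n)%N -> Clp iota p a -> star (star a) = a.
Proof.
move=> lepn ap; rewrite (star_mul_vol (leq_subr p n)); last exact: star_Clp.
by rewrite (star_mul_vol lepn) // -mulrA vol_sqr mulr1.
Qed.

Lemma starVK a : (star^-1)%VF (star a) = a.
Proof. by case: star_hodge => /lker0_lfunK. Qed.

Lemma starV p a : (p <= n)%N -> Clp iota p a -> (star^-1)%VF a = star a.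
Proof. by move=> lepn ap; rewrite -[in LHS](starK lepn ap) starVK. Qed.

End HodgeStar.

(** * The tensor square of the Clifford algebra *)

Section Tensor.

Context (R : realType) (Cl : falgType R[i]).
Local Notation d := (\dim {:Cl}).
Local Notation e := (vbasis {:Cl}).

(** The matrix of f for column vectors of coordinates: left multiplication by it
    applies f to the first tensor factor, and right multiplication by its
    transpose applies f to the second one. *)
Definition lmx (f : Cl -> Cl) : 'M[R[i]]_d := \matrix_(k, l) coord e k (f e`_l).

Lemma coord_lmx (f : {linear Cl -> Cl}) a k :
  coord e k (f a) = \sum_l lmx f k l * coord e l a.
Proof.
rewrite {1}(coord_vbasis (memvf a)) !linear_sum /=; apply: eq_bigr => l _.
by rewrite !linearZ /= mxE mulrC.
Qed.

Lemma tensor_mapl (f : {linear Cl -> Cl}) a b : tensor (f a) b = lmx f *m tensor a b.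
Proof.
apply/matrixP => k l; rewrite !mxE coord_lmx mulr_suml.
by apply: eq_bigr => i _; rewrite [tensor a b _ _]mxE mulrA.
Qed.

Lemma tensor_tr (a b : Cl) : (tensor a b)^T = tensor b a.
Proof. by apply/matrixP => k l; rewrite !mxE mulrC. Qed.

Lemma tensor_mapr (f : {linear Cl -> Cl}) a b : tensor a (f b) = tensor a b *m (lmx f)^T.
Proof. by rewrite -tensor_tr tensor_mapl trmx_mul tensor_tr. Qed.

Lemma lmx_comp (f g : {linear Cl -> Cl}) : lmx (f \o g) = lmx f *m lmx g.
Proof.
apply/matrixP => k l; rewrite !mxE /= coord_lmx.
by apply: eq_bigr => i _; rewrite [lmx g _ _]mxE.
Qed.

Lemma lmx_id : lmx (idfun : Cl -> Cl) = 1%:M.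
Proof.
by apply/matrixP => k l; rewrite !mxE /= (coord_free _ _ (basis_free (vbasisP _))) eq_sym.
Qed.

Lemma tensorPl z (a a' b : Cl) : tensor (z *: a + a') b = z *: tensor a b + tensor a' b.
Proof. by apply/matrixP => k l; rewrite !mxE linearP /= mulrDl mulrA. Qed.

Lemma tensorPr z (a b b' : Cl) : tensor a (z *: b + b') = z *: tensor a b + tensor a b'.
Proof. by rewrite -tensor_tr tensorPl linearP /= !tensor_tr. Qed.

Lemma tensor0l (b : Cl) : tensor 0 b = 0.
Proof. by apply/matrixP => k l; rewrite !mxE linear0 mul0r. Qed.

Lemma tensor0r (a : Cl) : tensor a 0 = 0.
Proof. by rewrite -tensor_tr tensor0l trmx0. Qed.

Lemma tensorZl z (a b : Cl) : tensor (z *: a) b = z *: tensor a b.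
Proof. by rewrite -[z *: a]addr0 tensorPl tensor0l addr0. Qed.

Lemma tensorNl (a b : Cl) : tensor (- a) b = - tensor a b.
Proof. by rewrite -scaleN1r tensorZl scaleN1r. Qed.

Lemma tensorNr (a b : Cl) : tensor a (- b) = - tensor a b.
Proof. by rewrite -tensor_tr tensorNl linearN /= tensor_tr. Qed.

Lemma tensorZr z (a b : Cl) : tensor a (z *: b) = z *: tensor a b.
Proof. by rewrite -tensor_tr tensorZl linearZ /= tensor_tr. Qed.

Lemma tensor_suml (I : Type) (r : seq I) (P : pred I) (F : I -> Cl) b :
  tensor (\sum_(i <- r | P i) F i) b = \sum_(i <- r | P i) tensor (F i) b.
Proof.
elim/big_rec2: _ => [|i a m _ <-]; first exact: tensor0l.
by rewrite -[F i]scale1r tensorPl !scale1r.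
Qed.

Lemma tensor_sumr (I : Type) (r : seq I) (P : pred I) (F : I -> Cl) a :
  tensor a (\sum_(i <- r | P i) F i) = \sum_(i <- r | P i) tensor a (F i).
Proof.
rewrite -tensor_tr tensor_suml linear_sum /=.
by apply: eq_bigr => i _; rewrite tensor_tr.
Qed.

Lemma tensor_eq0l (a b : Cl) : tensor a b = 0 -> b != 0 -> a = 0.
Proof.
move=> ab0 b0; have [l bl] : exists l, coord e l b != 0.
  apply/existsP; apply: contraNT b0; rewrite negb_exists => /forallP b0.
  rewrite (coord_vbasis (memvf b)) big1 // => l _.
  by have /eqP -> := negbNE (b0 l); rewrite scale0r.
rewrite (coord_vbasis (memvf a)) big1 // => k _.
have /matrixP /(_ k l) := ab0; rewrite !mxE => /eqP.
by rewrite mulf_eq0 (negPf bl) orbF => /eqP ->; rewrite scale0r.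
Qed.

End Tensor.

(** * Pair symmetry from the first Bianchi identity *)

Section WeylReflection.

(* t s s' stands for the tensor product of the exterior monomials of s and s',
   E' for contraction (x) wedge and F' for wedge (x) contraction. *)
Context (M : zmodType) (V : Type) (t : seq V -> seq V -> M).
Hypothesis tC : forall x y s s', t [:: y, x & s] s' = - t [:: x, y & s] s'.
Context (E' F' : {additive M -> M}).
Hypothesis E'1 : forall a s, E' (t [:: a] s) = t [::] (a :: s).
Hypothesis E'2 : forall a b s,
  E' (t [:: a; b] s) = t [:: b] (a :: s) - t [:: a] (b :: s).
Hypothesis F'3 : forall a b c s, F' (t s [:: a; b; c]) =
  t (a :: s) [:: b; c] - t (b :: s) [:: a; c] + t (c :: s) [:: a; b].
Hypothesis F'4 : forall a b c d s, F' (t s [:: a; b; c; d]) =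
  t (a :: s) [:: b; c; d] - t (b :: s) [:: a; c; d] +
  t (c :: s) [:: a; b; d] - t (d :: s) [:: a; b; c].
Hypothesis t4C : forall a b s s', t s [:: b, a & s'] = - t s [:: a, b & s'].

(** Vectors of weight 0 in a representation of sl_2 are acted on by the Weyl
    reflection through the sum over k of (- 1)^k F'^k E'^k / (k!)^2, which stops
    at k = 2 on Lambda^2 (x) Lambda^2; that this reflection exchanges the two
    factors is verified on decomposable elements.  The identity is multiplied
    by 4 to hold in any abelian group. *)
Lemma weyl_reflection a b c d (m := t [:: a; b] [:: c; d]) :
  (t [:: c; d] [:: a; b] - m) *+ 4 = F' (F' (E' (E' m))) - F' (E' m) *+ 4.
Proof.
pose S := m - t [:: a; c] [:: b; d] + t [:: a; d] [:: b; c] +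
          t [:: b; c] [:: a; d] - t [:: b; d] [:: a; c].
have swap := (tC a b, tC a c, tC a d, tC b c, tC b d, tC c d).
have FE : F' (E' m) = S + m.
  rewrite E'2 raddfB !F'3 !swap !opprD !opprK !addrA.
  by rewrite [LHS](ACl (1*5*6*2*3*4)).
have FF : F' (F' (t [::] [:: a; b; c; d])) = - (S + t [:: c; d] [:: a; b]) *+ 2.
  rewrite F'4 !(raddfB F') raddfD (raddfB F') !F'3 !swap !opprD !opprK !addrA.
  by rewrite [LHS](ACl (1*2*3*5*6*9*4*7*10*8*11*12)) mulr2n !addrA.
rewrite FE E'2 raddfB !E'1 (t4C a b) -opprD -mulr2n !(raddfN F') !(raddfMn F') FF.
rewrite !mulNrn opprK -mulrnA -[(2 * 2)%N]/4%N -mulrnBl; congr (_ *+ _).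
by rewrite opprD addrACA subrr add0r.
Qed.

End WeylReflection.

Section PairSymmetry.

Context (R : realType) (V : vectType R) (eta : {symmetric V}).
Context (Cl : falgType R[i]) (iota : {rlinear V -> Cl}).
Hypothesis Cl_clifford : clifford_algebra eta iota.
Context (al : {lrmorphism Cl -> Cl}).
Hypothesis al_iota : forall v, al (iota v) = - iota v.
Hypothesis alK : involutive al.
Context (n : nat) (xi sh : 'I_n -> V).
Hypothesis sh_expand : forall v, v = \sum_i eta (xi i) v *: sh i.

Local Notation cwedge := (cwedge iota al).
Local Notation ccontr := (ccontr iota al).
Local Notation M := 'M[R[i]]_(\dim {:Cl}).

(** The operators E' and F' on the tensor square of Cl, independent of the
    bidegree; the second one is defined as the first one conjugated by the
    exchange of the factors, and [wedge_contrE] gives its expected formula. *)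
Definition contr_wedge (m : M) : M :=
  \sum_i lmx (ccontr (xi i)) *m m *m (lmx (cwedge (sh i)))^T.

Definition wedge_contr (m : M) : M := (contr_wedge m^T)^T.

Lemma wedge_contr_tr m : wedge_contr m = (contr_wedge m^T)^T.
Proof. by []. Qed.

Lemma contr_wedge_is_linear : linear contr_wedge.
Proof.
move=> z m m'; rewrite /contr_wedge scaler_sumr -big_split /=.
by apply: eq_bigr => i _; rewrite mulmxDr mulmxDl -scalemxAr -scalemxAl.
Qed.

HB.instance Definition _ :=
  GRing.isLinear.Build R[i] M M _ contr_wedge contr_wedge_is_linear.

Lemma wedge_contr_is_linear : linear wedge_contr.
Proof. by move=> z m m'; rewrite /wedge_contr linearP /= linearP /= linearP. Qed.

HB.instance Definition _ :=
  GRing.isLinear.Build R[i] M M _ wedge_contr wedge_contr_is_linear.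

Lemma lmx_cwedge_sum (z : 'I_n -> R) (f : 'I_n -> V) :
  lmx (cwedge (\sum_i z i *: f i)) = \sum_i real_complex R (z i) *: lmx (cwedge (f i)).
Proof.
apply/matrixP => k l; rewrite summxE mxE cwedge_suml linear_sum /=.
by apply: eq_bigr => i _; rewrite linearZ /= !mxE.
Qed.

Lemma lmx_ccontr_sum (z : 'I_n -> R) (f : 'I_n -> V) :
  lmx (ccontr (\sum_i z i *: f i)) = \sum_i real_complex R (z i) *: lmx (ccontr (f i)).
Proof.
apply/matrixP => k l; rewrite summxE mxE ccontr_suml linear_sum /=.
by apply: eq_bigr => i _; rewrite linearZ /= !mxE.
Qed.

(** The tensor sum_i xi_i (x) sh_i is symmetric: the expansion of xi_i in the sh_j
    has the coefficients eta (xi j) (xi i) of a symmetric matrix. *)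
Lemma wedge_contrE m :
  wedge_contr m = \sum_i lmx (cwedge (xi i)) *m m *m (lmx (ccontr (sh i)))^T.
Proof.
pose g i j := real_complex R (eta (xi j) (xi i)).
have gC i j : g i j = g j i.
  by rewrite /g hermC /= expr0 mul1r.
have CE i : lmx (ccontr (xi i)) = \sum_j g i j *: lmx (ccontr (sh j)).
  by rewrite {1}[xi i]sh_expand lmx_ccontr_sum.
have WE i : lmx (cwedge (xi i)) = \sum_j g i j *: lmx (cwedge (sh j)).
  by rewrite {1}[xi i]sh_expand lmx_cwedge_sum.
rewrite /wedge_contr /contr_wedge linear_sum /=.
under eq_bigr => i _.
  rewrite !trmx_mul !trmxK mulmxA CE linear_sum /= mulmx_sumr.
  over.
under [RHS]eq_bigr => i _.
  rewrite WE !mulmx_suml.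
  over.
rewrite exchange_big; apply: eq_bigr => i _; apply: eq_bigr => j _.
by rewrite linearZ /= -scalemxAr -!scalemxAl gC.
Qed.

Lemma contr_wedge_tensor1 b : contr_wedge (tensor 1 b) = 0.
Proof.
rewrite /contr_wedge big1 // => i _.
by rewrite -tensor_mapl /= ccontr1 tensor0l mul0mx.
Qed.

(** Contraction with the xi_i is an antiderivation, and sum_i eta(xi_i, v) sh_i = v:
    E' moves the leading vector of the first factor to the second one. *)
Lemma contr_wedge_cwedge v a b : contr_wedge (tensor (cwedge v a) b) =
  tensor a (cwedge v b) - lmx (cwedge v) *m contr_wedge (tensor a b).
Proof.
have -> : tensor a (cwedge v b) =
    \sum_i real_complex R (eta (xi i) v) *: tensor a (cwedge (sh i) b).
  rewrite {1}[v]sh_expand cwedge_suml tensor_sumr.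
  by apply: eq_bigr => i _; rewrite tensorZr.
rewrite /contr_wedge mulmx_sumr -sumrB; apply: eq_bigr => i _.
rewrite -!tensor_mapl -!tensor_mapr -tensor_mapl /=.
rewrite (ccontr_cwedge Cl_clifford) // tensorPl.
by rewrite -[- _ in LHS]scaleN1r tensorZl scaleN1r.
Qed.

Local Notation t s1 s2 := (tensor (wedges iota s1) (wedges iota s2)).

Lemma lmx_wedges v s s' : lmx (cwedge v) *m t s s' = t (v :: s) s'.
Proof. by rewrite -tensor_mapl (wedges_cons al_iota). Qed.

Lemma contr_wedge1 a s : contr_wedge (t [:: a] s) = t [::] (a :: s).
Proof.
by rewrite !(wedges_cons al_iota) contr_wedge_cwedge contr_wedge_tensor1 mulmx0 subr0.
Qed.

Lemma contr_wedge2 a b s :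
  contr_wedge (t [:: a; b] s) = t [:: b] (a :: s) - t [:: a] (b :: s).
Proof.
rewrite (wedges_cons al_iota a [:: b]) contr_wedge_cwedge contr_wedge1.
by rewrite lmx_wedges (wedges_cons al_iota a s).
Qed.

Lemma contr_wedge3 a b c s : contr_wedge (t [:: a; b; c] s) =
  t [:: b; c] (a :: s) - t [:: a; c] (b :: s) + t [:: a; b] (c :: s).
Proof.
rewrite (wedges_cons al_iota a [:: b; c]) contr_wedge_cwedge contr_wedge2.
by rewrite mulmxBr !lmx_wedges -(wedges_cons al_iota) opprB addrA addrAC.
Qed.

Lemma contr_wedge4 a b c d s : contr_wedge (t [:: a; b; c; d] s) =
  t [:: b; c; d] (a :: s) - t [:: a; c; d] (b :: s) +
  t [:: a; b; d] (c :: s) - t [:: a; b; c] (d :: s).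
Proof.
rewrite (wedges_cons al_iota a [:: b; c; d]) contr_wedge_cwedge contr_wedge3.
rewrite mulmxDr mulmxBr !lmx_wedges -(wedges_cons al_iota).
by rewrite opprD opprB !addrA; congr (_ - _); rewrite addrAC.
Qed.

Lemma wedge_contr3 a b c s : wedge_contr (t s [:: a; b; c]) =
  t (a :: s) [:: b; c] - t (b :: s) [:: a; c] + t (c :: s) [:: a; b].
Proof.
by rewrite /wedge_contr tensor_tr contr_wedge3 linearD linearB /= !tensor_tr.
Qed.

Lemma wedge_contr4 a b c d s : wedge_contr (t s [:: a; b; c; d]) =
  t (a :: s) [:: b; c; d] - t (b :: s) [:: a; c; d] +
  t (c :: s) [:: a; b; d] - t (d :: s) [:: a; b; c].
Proof.
by rewrite /wedge_contr tensor_tr contr_wedge4 linearB linearD linearB /= !tensor_tr.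
Qed.

Lemma wedges_swap a b s : wedges iota [:: b, a & s] = - wedges iota [:: a, b & s].
Proof. by rewrite !(wedges_cons al_iota) (cwedgeC Cl_clifford). Qed.

Lemma pair_symmetry_decomposable a b c d (m := t [:: a; b] [:: c; d]) :
  (m^T - m) *+ 4 = wedge_contr (wedge_contr (contr_wedge (contr_wedge m)))
                   - wedge_contr (contr_wedge m) *+ 4.
Proof.
rewrite /m tensor_tr.
apply: (@weyl_reflection _ V (fun s s' => t s s') _ contr_wedge wedge_contr).
- by move=> x y s s'; rewrite wedges_swap tensorNl.
- exact: contr_wedge1.
- exact: contr_wedge2.
- exact: wedge_contr3.
- exact: wedge_contr4.
- by move=> x y s s'; rewrite wedges_swap tensorNr.
Qed.

(** The identity of [weyl_reflection] is linear in m, so it extends from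
    decomposable elements to Cl^2 (x) Cl^2, where its right-hand side vanishes
    as soon as E' m = 0. *)
Lemma contr_wedge0_sym (J : finType) (x y : J -> Cl)
    (m := \sum_j tensor (x j) (y j)) :
  (forall j, Clp iota 2 (x j)) -> (forall j, Clp iota 2 (y j)) ->
  contr_wedge m = 0 -> m^T = m.
Proof.
pose FE : {linear M -> M} := wedge_contr \o contr_wedge.
pose F2E2 : {linear M -> M} := wedge_contr \o (FE \o contr_wedge).
pose D : {linear M -> M} := 4 \*: (trmx \- idfun) \- (F2E2 \- 4 \*: FE).
have DE m' : D m' = (m'^T - m') *+ 4 -
    (wedge_contr (wedge_contr (contr_wedge (contr_wedge m')))
     - wedge_contr (contr_wedge m') *+ 4).
  by rewrite /D /= !scaler_nat.
clearbody D.
have D0 a b : Clp iota 2 a -> Clp iota 2 b -> D (tensor a b) = 0.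
  move=> a2; elim/Clp_ind: b / => [|z b b' Hb Hb'|].
  - by rewrite tensor0r linear0.
  - by rewrite tensorPr (linearP D) /= Hb Hb' scaler0 addr0.
  move=> [|b1 [|b2 [|//]]] // _.
  elim/Clp_ind: a / a2 => [|z a a' Ha Ha'|].
  - by rewrite tensor0l linear0.
  - by rewrite tensorPl (linearP D) /= Ha Ha' scaler0 addr0.
  move=> [|a1 [|a2 [|//]]] // _.
  by rewrite DE pair_symmetry_decomposable subrr.
move=> x2 y2 E0.
have : D m = 0.
  by rewrite /m (linear_sum D) big1 // => j _; exact: D0.
rewrite DE E0 !linear0 mul0rn !subr0 -scaler_nat => /eqP.
by rewrite scaler_eq0 pnatr_eq0 /= subr_eq0 => /eqP.
Qed.

End PairSymmetry.

(** * The coframe of a nondegenerate soldering form *)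

Section Frame.

Context (R : realType) (V : vectType R) (eta : {symmetric V}).
Hypothesis eta_nondeg : nondegenerate eta.
Context (Cl : falgType R[i]) (iota : {rlinear V -> Cl}).
Hypothesis Cl_clifford : clifford_algebra eta iota.

Lemma etaC u v : eta u v = eta v u.
Proof. by rewrite hermC /= expr0 mul1r. Qed.

Lemma eta_eq0 v : (forall u, eta u v = 0) -> v = 0.
Proof.
move=> v0; apply/eqP; rewrite -memv0 -(eqP eta_nondeg).
by apply/mem_orthovP => u _; rewrite etaC.
Qed.

(** If v is sent to 0, the Clifford relation makes v orthogonal to V. *)
Lemma iota_inj : injective iota.
Proof.
apply: raddf_inj => v v0; apply: eta_eq0 => u.
have := clifford_anticomm Cl_clifford u v; rewrite v0 mulr0 mul0r addr0.
move=> /esym /eqP; rewrite scaler_eq0 oner_eq0 orbF mulf_eq0 pnatr_eq0 /=.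
by rewrite (fmorph_eq0 (real_complex R)) => /eqP.
Qed.

(** The vectors xi_i are the images of the coordinate vector fields, and the
    vectors dual to the dx^i exist because the Gram matrix of the xi_i is
    invertible. *)
Lemma coframe_of_nondegenerate n (theta : ext n Cl) (sh := sharp eta iota theta) :
  nondegenerate_at iota theta ->
  exists xi : 'I_n -> V,
    [/\ forall i, theta [set i] = iota (xi i),
        forall i j, eta (xi i) (sh j) = (i == j)%:R
      & forall v, v = \sum_i eta (xi i) v *: sh i].
Proof.
case=> T [Tinv TK TinvK] thetaE.
pose xi i := T (delta_mx 0 i); exists xi.
have TE X : T X = \sum_i X 0 i *: xi i.
  by rewrite {1}[X]row_sum_delta linear_sum; apply: eq_bigr => i _; rewrite linearZ.
have xi_eq0 v : (forall i, eta (xi i) v = 0) -> v = 0.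
  move=> v0; apply: eta_eq0 => u; rewrite -[u]TinvK TE linear_sumlz.
  by apply: big1 => i _; rewrite linearZl_LR /= v0 mulr0.
pose G := \matrix_(i, j) eta (xi i) (xi j).
have G_unit : G \in unitmx.
  rewrite -row_free_unit; apply: inj_row_free => u uG.
  suff Tu : T u = 0 by rewrite -[u]TK Tu -(linear0 T) TK.
  apply: xi_eq0 => j; have /rowP /(_ j) := uG; rewrite !mxE => uGj.
  rewrite -[RHS]uGj etaC TE linear_sumlz; apply: eq_bigr => i _.
  by rewrite linearZl_LR /= mxE.
have sharpP i X : eta (sh i) (T X) = X 0 i.
  have : exists v, forall (X : 'rV[R]_n) (w : V),
      iota w = eval1 theta X -> eta v w = X 0 i.
    exists (T (row i (invmx G))) => Y w; rewrite thetaE => /iota_inj ->.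
    rewrite [T Y]TE linear_sumr; transitivity (\sum_k Y 0 k * (i == k)%:R).
      apply: eq_bigr => k _; rewrite linearZ /=; congr (_ * _).
      rewrite TE linear_sumlz /=.
      have /matrixP /(_ i k) := mulVmx G_unit; rewrite !mxE => <-.
      by apply: eq_bigr => l _; rewrite linearZl_LR /= !mxE.
    by rewrite (bigD1 i) //= eqxx mulr1 big1 ?addr0 // => k /negPf; rewrite eq_sym => ->; rewrite mulr0.
  by move=> /(xgetPex 0) /(_ X (T X)); apply; rewrite thetaE.
have eta_xi_sh i j : eta (xi i) (sh j) = (i == j)%:R.
  by rewrite etaC sharpP mxE eqxx /= eq_sym.
split=> // [i|v].
  rewrite -thetaE /eval1 (bigD1 i) //= mxE !eqxx /= rmorph1 scale1r big1 ?addr0 // => k ki.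
  by rewrite mxE (negPf ki) andbF rmorph0 scale0r.
apply/eqP; rewrite -subr_eq0; apply/eqP; apply: xi_eq0 => j.
rewrite linearBr linear_sumr /= (bigD1 j) //= linearZr_LR /= eta_xi_sh eqxx.
rewrite mulr1 big1 ?addr0 ?subrr // => i ij.
by rewrite linearZr_LR /= eta_xi_sh eq_sym (negPf ij) mulr0.
Qed.

End Frame.

(** * Clifford forms at a point as elements of the tensor square *)

Section Pointwise.

Context (R : realType) (V : vectType R) (eta : {symmetric V}).
Context (Cl : falgType R[i]) (iota : {rlinear V -> Cl}).
Hypothesis Cl_clifford : clifford_algebra eta iota.
Context (al : {lrmorphism Cl -> Cl}).
Hypothesis al_iota : forall v, al (iota v) = - iota v.
Hypothesis alK : involutive al.
Context (n : nat) (theta : ext n Cl) (xi : 'I_n -> V).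
Local Notation sh := (sharp eta iota theta).
Hypothesis theta_xi : forall i, theta [set i] = iota (xi i).
Hypothesis theta_deg : forall I : {set 'I_n}, #|I| != 1%N -> theta I = 0.
Hypothesis eta_xi_sh : forall i j, eta (xi i) (sh j) = (i == j)%:R.
Hypothesis sh_expand : forall v, v = \sum_i eta (xi i) v *: sh i.

Local Notation cwedge := (cwedge iota al).
Local Notation ccontr := (ccontr iota al).
Local Notation w s := (wedges iota [seq sh i | i <- s]).
Local Notation wI I := (w (enum I)).
Local Notation J := (symbol eta iota theta).
Local Notation basis I := (ext_basis R[i] I).

Lemma Clp_wI (I : {set 'I_n}) : Clp iota #|I| (wI I).
Proof. by rewrite cardE -(size_map sh); exact: Clp_wedges. Qed.

Lemma symbolE u : J u = \sum_(I : {set 'I_n}) u I *: wI I.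
Proof.
pose f (u : {ffun {set 'I_n} -> R[i]^o}) := \sum_(I : {set 'I_n}) u I *: wI I.
have f_lin : linear f.
  move=> z a b; rewrite /f scaler_sumr -big_split; apply: eq_bigr => I _.
  by rewrite !ffunE /= scalerDl scalerA.
pose fL := GRing.isLinear.Build _ _ _ _ f f_lin.
pose ff : {linear {ffun {set 'I_n} -> R[i]^o} -> Cl} := HB.pack f fL.
exact: (lfunE ff).
Qed.

Lemma symbol_basis I : J (basis I) = wI I.
Proof.
rewrite symbolE (bigD1 I) //= ffunE eqxx scale1r big1 ?addr0 // => K KI.
by rewrite ffunE (negPf KI) scale0r.
Qed.

Lemma coframe_coef_eq0 (u : {set 'I_n} -> R[i]) :
  \sum_(I : {set 'I_n}) u I *: wI I = 0 -> forall I, u I = 0.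
Proof.
move=> u0 I; have [P HP] := coframe_projector Cl_clifford al_iota alK eta_xi_sh I.
have := congr1 P u0; rewrite linear0 linear_sum (bigD1 I) //= big1 => [|K KI]; last first.
  by rewrite linearZ /= HP (negPf KI) scale0r scaler0.
rewrite addr0 linearZ /= HP eqxx scale1r => /eqP; rewrite scaler_eq0 => /orP [/eqP //|].
by rewrite (negPf (w_neq0 Cl_clifford al_iota alK eta_xi_sh (enum_uniq _))).
Qed.

Lemma symbolK u : (J^-1)%VF (J u) = u.
Proof.
apply: lker0_lfunK; apply/lker0P; apply: raddf_inj => u'.
by rewrite /= symbolE => /coframe_coef_eq0 u'0; apply/ffunP => I; rewrite u'0 ffunE.
Qed.

Lemma symbolV_wI (I : {set 'I_n}) : (J^-1)%VF (wI I) = basis I.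
Proof. by rewrite -symbol_basis symbolK. Qed.

(** The image of [symbol] is spanned by the monomials, so it contains every
    Cl^p. *)
Lemma symbolVK p a : Clp iota p a -> J ((J^-1)%VF a) = a.
Proof.
elim/(Clp_ind_coframe Cl_clifford al_iota alK sh_expand): a / => [|z a b Ha Hb|I _].
- by rewrite !linear0.
- by rewrite !linearP /= Ha Hb.
by rewrite symbolV_wI symbol_basis.
Qed.

Lemma symbolV_deg p a (K : {set 'I_n}) : Clp iota p a -> #|K| != p -> (J^-1)%VF a K = 0.
Proof.
move=> + Kp.
elim/(Clp_ind_coframe Cl_clifford al_iota alK sh_expand): a / => [|z a b Ha Hb|I Ip].
- by rewrite linear0 ffunE.
- by rewrite linearP !ffunE /= Ha Hb scaler0 addr0.
rewrite symbolV_wI ffunE; case: eqVneq => // KI.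
by rewrite KI Ip eqxx in Kp.
Qed.

(** This is the matrix whose symmetry [symmetric_at] expresses. *)
Definition symbol2 (x : ext n Cl) : 'M[R[i]]_(\dim {:Cl}) :=
  \sum_(I : {set 'I_n}) tensor (x I) (J (basis I)).

Lemma symbol2E x : symbol2 x = \sum_(I : {set 'I_n}) tensor (x I) (wI I).
Proof. by apply: eq_bigr => I _; rewrite symbol_basis. Qed.

Lemma symbol2_eq0 x : symbol2 x = 0 -> x = 0.
Proof.
rewrite symbol2E => x0; apply/ffunP => I; rewrite [RHS]ffunE.
have [P HP] := coframe_projector Cl_clifford al_iota alK eta_xi_sh I.
have := congr1 (fun m => m *m (lmx P)^T) x0; rewrite mul0mx mulmx_suml.
rewrite (bigD1 I) //= big1 => [|K KI]; last first.
  by rewrite -tensor_mapr HP (negPf KI) scale0r tensor0r.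
rewrite addr0 -tensor_mapr HP eqxx scale1r => /tensor_eq0l; apply.
by rewrite (w_neq0 Cl_clifford al_iota alK eta_xi_sh (enum_uniq _)).
Qed.

Lemma symbol2B x y : symbol2 (x - y) = symbol2 x - symbol2 y.
Proof.
rewrite /symbol2 -sumrB; apply: eq_bigr => I _.
by rewrite !ffunE -[- y I]scaleN1r addrC tensorPl scaleN1r addrC.
Qed.

Lemma symbol2_inj : injective symbol2.
Proof.
move=> x y xy; apply/eqP; rewrite -subr_eq0; apply/eqP; apply: symbol2_eq0.
by rewrite symbol2B xy subrr.
Qed.

Lemma symbol2_on_cliff (f : 'End(Cl)) x : symbol2 (on_cliff f x) = lmx f *m symbol2 x.
Proof. by rewrite mulmx_sumr; apply: eq_bigr => I _; rewrite ffunE tensor_mapl. Qed.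

Lemma symbol2_on_form (f : 'End(Cl)) (x : ext n Cl) :
  (forall I : {set 'I_n}, x I != 0 -> J ((J^-1)%VF (f (wI I))) = f (wI I)) ->
  symbol2 (on_form eta iota theta f x) = symbol2 x *m (lmx f)^T.
Proof.
move=> Jf; rewrite [symbol2 x]symbol2E mulmx_suml symbol2E.
under eq_bigr => K _ do rewrite ffunE tensor_suml.
rewrite exchange_big; apply: eq_bigr => I _ /=.
have [->|xI0] := eqVneq (x I) 0.
  by rewrite tensor0l mul0mx big1 // => K _; rewrite scaler0 tensor0l.
rewrite symbol_basis -tensor_mapr /= -[in RHS](Jf _ xI0) symbolE tensor_sumr.
by apply: eq_bigr => K _; rewrite tensorZl tensorZr.
Qed.

Lemma Omega_on_form (f : 'End(Cl)) p q q' x :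
  Omega_at iota p q x -> (forall a, Clp iota q a -> Clp iota q' (f a)) ->
  Omega_at iota p q' (on_form eta iota theta f x).
Proof.
move=> xO fq K; split.
  by rewrite ffunE; apply: Clp_sum => I _; apply: ClpZ; case: (xO I).
move=> Kq; rewrite ffunE big1 // => I _; have [_ xI] := xO I.
have [Iq|/xI ->] := eqVneq #|I| q; last by rewrite scaler0.
rewrite (symbolV_deg (fq _ _) Kq) ?scale0r // symbol_basis -Iq.
exact: Clp_wI.
Qed.

Lemma Omega_on_cliff (f : 'End(Cl)) p p' q (x : ext n Cl) :
  Omega_at iota p q x -> (forall a, Clp iota p a -> Clp iota p' (f a)) ->
  Omega_at iota p' q (on_cliff f x).
Proof.
move=> xO fp I; rewrite ffunE; have [xp xq] := xO I.
by split=> [|/xq ->]; [exact: fp | rewrite linear0].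
Qed.

Lemma ext_mul1l (y : ext n Cl) K : ext_mul theta y K =
  \sum_(i in K) shuffle_sign R[i] [set i] (K :\ i) *: (iota (xi i) * y (K :\ i)).
Proof.
rewrite ffunE sum_subset1 => [|I _ /theta_deg ->]; last by rewrite mul0r scaler0.
by apply: eq_bigr => i _; rewrite theta_xi.
Qed.

(** The sum over the index I of the left factor is reindexed by K :\: I, the index
    of theta. *)
Lemma ext_mul1r (y : ext n Cl) K : ext_mul y theta K =
  \sum_(i in K) shuffle_sign R[i] (K :\ i) [set i] *: (y (K :\ i) * iota (xi i)).
Proof.
rewrite ffunE (reindex_onto (fun I => K :\: I) (fun I => K :\: I)); last first.
  by move=> I IK; rewrite finset.setDDr finset.setDv finset.set0U; apply/finset.setIidPr.
rewrite (eq_bigl (fun I : {set 'I_n} => I \subset K)); last first.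
  move=> I; rewrite finset.subsetDl finset.setDDr finset.setDv finset.set0U /=.
  by apply/eqP/idP => [<-|/finset.setIidPr //]; rewrite finset.subsetIl.
rewrite sum_subset1 => [|I /finset.setIidPr IK I1]; last first.
  by rewrite finset.setDDr finset.setDv finset.set0U IK theta_deg // mulr0 scaler0.
apply: eq_bigr => i iK; rewrite -theta_xi.
have /finset.setIidPr iKE : [set i] \subset K by rewrite finset.sub1set.
by rewrite finset.setDDr finset.setDv finset.set0U iKE.
Qed.

(** Moving dx^i across a form of degree q costs (-1)^q, which turns the sign
    (-1)^(p + q) of E into the sign (-1)^p of the wedge action on Cl^p. *)
Lemma E_atE p q x : Omega_at iota p q x -> forall K, E_at theta p q x K =
  \sum_(i in K) shuffle_sign R[i] [set i] (K :\ i) *: cwedge (xi i) (x (K :\ i)).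
Proof.
move=> xO K.
have addE (y z : ext n Cl) : (y + z) K = y K + z K by rewrite ffunE.
have scaleE k (y : ext n Cl) : (k *: y) K = k *: y K by rewrite ffunE.
rewrite /E_at scaleE addE scaleE ext_mul1l ext_mul1r scaler_sumr -big_split scaler_sumr.
apply: eq_bigr => i iK /=; have [xp xq] := xO (K :\ i).
rewrite -(wedge_act_Clp al_iota _ xp) /wedge_act.
have [Kq|/xq ->] := eqVneq #|K :\ i| q; last first.
  by rewrite !(mulr0, mul0r, scaler0) addr0 !scaler0.
rewrite shuffle_sign_r1 ?inE ?eqxx // Kq.
set sg := shuffle_sign _ _ _; set b := x _ * _.
have -> : (-1) ^+ (p + q) *: (((-1) ^+ q * sg) *: b) = sg *: ((-1) ^+ p *: b).
  rewrite !scalerA; congr (_ *: _).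
  by rewrite exprD mulrA -[_ * _ * (-1) ^+ q]mulrA -expr2 sqrr_sign mulr1 mulrC.
by rewrite -scalerDr !scalerA mulrC.
Qed.

Lemma symbol2_conj (f g : {linear Cl -> Cl}) x :
  lmx f *m symbol2 x *m (lmx g)^T =
  \sum_(I : {set 'I_n}) tensor (f (x I)) (g (wI I)).
Proof.
rewrite symbol2E mulmx_sumr mulmx_suml; apply: eq_bigr => I _.
by rewrite -tensor_mapl -tensor_mapr.
Qed.

Lemma symbol2_E p q x : Omega_at iota p q x ->
  symbol2 (E_at theta p q x) =
  \sum_i lmx (cwedge (xi i)) *m symbol2 x *m (lmx (cwedge (sh i)))^T.
Proof.
move=> xO; rewrite symbol2E.
under eq_bigr => K _ do rewrite (E_atE xO) tensor_suml.
rewrite (exchange_big_dep predT) //=; apply: eq_bigr => i _.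
rewrite symbol2_conj [RHS](bigID (fun I : {set 'I_n} => i \in I)) /= [X in X + _]big1 ?add0r.
  rewrite (reindex_onto (fun I => i |: I) (fun I => I :\ i)) /=; last first.
    by move=> I iI; rewrite finset.setD1K.
  apply: eq_big => [I|I iI].
    rewrite finset.setU11 /=; apply/eqP/idP => [<-|iI]; first by rewrite !inE eqxx.
    by rewrite finset.setU1K.
  have {}iI : i \notin I by case/andP: iI => _ /eqP <-; rewrite !inE eqxx.
  rewrite finset.setU1K // tensorZl -tensorZr.
  by rewrite (cwedge_wI Cl_clifford al_iota alK) (negPf iI).
by move=> I iI; rewrite (cwedge_wI Cl_clifford al_iota alK) iI tensor0r.
Qed.

(** * The Hodge stars and the operators on Clifford forms *)

Hypothesis dimV : \dim {:V} = n.
Hypothesis n_even : ~~ odd n.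
Context (vol : Cl) (vol_top : Clp iota n vol) (vol_sqr : vol * vol = 1).
Context (star : 'End(Cl)) (star_hodge : hodge_star iota vol star).

Local Notation star2 := (on_form eta iota theta).
Local Notation starK := (starK Cl_clifford al_iota alK eta_xi_sh sh_expand dimV
  n_even vol_top vol_sqr star_hodge).
Local Notation starV := (starV Cl_clifford al_iota alK eta_xi_sh sh_expand dimV
  n_even vol_top vol_sqr star_hodge).
Local Notation star_Clp := (star_Clp dimV star_hodge).
Local Notation contr_wedge := (contr_wedge iota al xi sh).
Local Notation wedge_contr := (wedge_contr iota al xi sh).

Lemma starV_cwedge_star q v a : (q <= n)%N -> Clp iota q a ->
  (star^-1)%VF (cwedge v (star a)) = ccontr v a.
Proof.
move=> qn aq; have aq' := star_Clp qn aq.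
rewrite -(wedge_act_Clp al_iota _ aq') (star_contr_act dimV star_hodge) //.
by rewrite (starVK star_hodge) (contr_act_Clp al_iota).
Qed.

Lemma star_wI (I : {set 'I_n}) : J ((J^-1)%VF (star (wI I))) = star (wI I).
Proof.
apply: (@symbolVK (n - #|I|)); apply: star_Clp (Clp_wI I).
by rewrite -[X in (_ <= X)%N]card_ord max_card.
Qed.

Lemma starV_wI (I : {set 'I_n}) : (star^-1)%VF (wI I) = star (wI I).
Proof.
by apply: starV (Clp_wI I); rewrite -[X in (_ <= X)%N]card_ord max_card.
Qed.

Lemma symbol2_star2 x : symbol2 (star2 star x) = symbol2 x *m (lmx star)^T.
Proof. by apply: symbol2_on_form => I _; exact: star_wI. Qed.

Lemma symbol2_star2V x :
  symbol2 (star2 (star^-1)%VF x) = symbol2 x *m (lmx (star^-1)%VF)^T.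
Proof. by apply: symbol2_on_form => I _; rewrite starV_wI; exact: star_wI. Qed.

Lemma on_cliff_starK p q (x : ext n Cl) : (p <= n)%N -> Omega_at iota p q x ->
  on_cliff star (on_cliff star x) = x.
Proof.
move=> pn xO; apply/ffunP => I; rewrite !ffunE.
by have [xp _] := xO I; exact: starK pn xp.
Qed.

Lemma on_form_starK (x : ext n Cl) : star2 star (star2 star x) = x.
Proof.
apply: symbol2_inj; rewrite !symbol2_star2 -mulmxA -trmx_mul -lmx_comp.
rewrite -[LHS]mul1mx mulmxA -lmx_id symbol2_conj symbol2E.
apply: eq_bigr => I _ /=.
congr (tensor _ _); apply: starK (Clp_wI I).
by rewrite -[X in (_ <= X)%N]card_ord max_card.
Qed.

Lemma star12C x : on_cliff star (star2 star x) = star2 star (on_cliff star x).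
Proof. by apply: symbol2_inj; rewrite symbol2_on_cliff !symbol2_star2 symbol2_on_cliff mulmxA. Qed.

Lemma Omega_star1 p q (x : ext n Cl) : (p <= n)%N -> Omega_at iota p q x ->
  Omega_at iota (n - p) q (on_cliff star x).
Proof. by move=> pn /Omega_on_cliff; apply => a; exact: star_Clp. Qed.

Lemma Omega_star2 p q x : (q <= n)%N -> Omega_at iota p q x ->
  Omega_at iota p (n - q) (star2 star x).
Proof. by move=> qn /Omega_on_form; apply => a; exact: star_Clp. Qed.

Lemma symbol2_E' p q x : (p <= n)%N -> Omega_at iota p q x ->
  symbol2 (E'_at star theta p q x) = contr_wedge (symbol2 x).
Proof.
move=> pn xO; rewrite /E'_at symbol2_on_cliff (symbol2_E (Omega_star1 pn xO)).
rewrite symbol2_on_cliff mulmx_sumr; apply: eq_bigr => i _.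
rewrite !mulmxA -!lmx_comp !symbol2_conj; apply: eq_bigr => I _ /=.
by congr (tensor _ _); apply: starV_cwedge_star pn _; case: (xO I).
Qed.

Lemma symbol2_F' p q x : (q <= n)%N -> Omega_at iota p q x ->
  symbol2 (F'_at eta iota star theta p q x) = wedge_contr (symbol2 x).
Proof.
move=> qn xO; rewrite /F'_at symbol2_star2V (symbol2_E (Omega_star2 qn xO)).
rewrite symbol2_star2 mulmx_suml (wedge_contrE _ _ sh_expand); apply: eq_bigr => i _.
rewrite -!mulmxA -!trmx_mul !mulmxA -!lmx_comp !symbol2_conj; apply: eq_bigr => I _ /=.
have [_ xI] := xO I; have [Iq|/xI ->] := eqVneq #|I| q; last first.
  by rewrite linear0 !tensor0l.
by congr (tensor _ _); apply: starV_cwedge_star qn _; rewrite -Iq; exact: Clp_wI.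
Qed.

(** F is F' conjugated by star_1; the composite in the definition of F contains
    the one in the definition of F' literally. *)
Lemma F_atE p q x : F_at eta iota star theta p q x =
  on_cliff (star^-1)%VF (F'_at eta iota star theta (n - p) q (on_cliff star x)).
Proof. by []. Qed.

Lemma on_cliff_starV_eq0 (x : ext n Cl) : on_cliff (star^-1)%VF x = 0 -> x = 0.
Proof.
move=> x0; apply/ffunP => I; have := congr1 (fun y : ext n Cl => star (y I)) x0.
rewrite !ffunE linear0 lker0_lfunVK //; by case: star_hodge.
Qed.

Lemma on_cliff0 (f : 'End(Cl)) : on_cliff f (0 : ext n Cl) = 0.
Proof. by apply/ffunP => I; rewrite !ffunE linear0. Qed.

Lemma symbol2_0 : symbol2 (0 : ext n Cl) = 0.
Proof. by rewrite -[0 in LHS](subrr 0) symbol2B subrr. Qed.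

(** * Einstein equation and invariance in dimension four *)

(* From here on star_1 and star_2 preserve the bidegree (2, 2). *)
Hypothesis n4 : n = 4%N.

Let n_ge2 : (2 <= n)%N. Proof. by rewrite n4. Qed.
Let n_sub2 : (n - 2 = 2)%N. Proof. by rewrite n4. Qed.

Lemma symbol2_bivectors x : Omega_at iota 2 2 x -> exists y : {set 'I_n} -> Cl,
  (forall I, Clp iota 2 (y I)) /\ symbol2 x = \sum_(I : {set 'I_n}) tensor (x I) (y I).
Proof.
move=> xO; exists (fun I : {set 'I_n} => if #|I| == 2%N then wI I else 0).
split=> [I|]; first by case: ifPn => [/eqP <-|_]; [exact: Clp_wI | exact: Clp0].
rewrite symbol2E; apply: eq_bigr => I _; case: ifPn => // I2.
by have [_ ->] := xO I; rewrite ?tensor0l.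
Qed.

Lemma E'0_pair_symmetric x : Omega_at iota 2 2 x ->
  E'_at star theta 2 2 x = 0 -> (symbol2 x)^T = symbol2 x.
Proof.
move=> xO E0; have := symbol2_E' n_ge2 xO; rewrite E0 symbol2_0.
have [y [y2 ->]] := symbol2_bivectors xO => /esym.
by apply: (contr_wedge0_sym Cl_clifford al_iota alK sh_expand) => // I; case: (xO I).
Qed.

(** The transpose of [symbol2 x] is annihilated by E', hence is symmetric. *)
Lemma F'0_pair_symmetric x : Omega_at iota 2 2 x ->
  F'_at eta iota star theta 2 2 x = 0 -> (symbol2 x)^T = symbol2 x.
Proof.
move=> xO F0; have := symbol2_F' n_ge2 xO; rewrite F0 symbol2_0 => /esym.
move=> /(congr1 trmx); rewrite wedge_contr_tr trmxK trmx0.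
have [y [y2 ->]] := symbol2_bivectors xO; rewrite linear_sum /=.
under eq_bigr do rewrite tensor_tr.
move=> C0; apply: esym.
rewrite -[RHS](contr_wedge0_sym Cl_clifford al_iota alK sh_expand _ _ C0) //.
  by rewrite linear_sum /=; apply: eq_bigr => I _; rewrite tensor_tr.
by move=> I; case: (xO I).
Qed.

Lemma E'0_iff_F'0 x : Omega_at iota 2 2 x ->
  E'_at star theta 2 2 x = 0 <-> F'_at eta iota star theta 2 2 x = 0.
Proof.
move=> xO; split=> x0; apply: symbol2_eq0.
  rewrite (symbol2_F' n_ge2 xO) wedge_contr_tr (E'0_pair_symmetric xO x0).
  by rewrite -(symbol2_E' n_ge2 xO) x0 symbol2_0 trmx0.
rewrite (symbol2_E' n_ge2 xO) -(F'0_pair_symmetric xO x0) -[LHS]trmxK.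
by rewrite -[X in X^T](symbol2_F' n_ge2 xO) x0 symbol2_0 trmx0.
Qed.

Lemma F0_iff_F'0_star1 x : F_at eta iota star theta 2 2 x = 0 <->
  F'_at eta iota star theta 2 2 (on_cliff star x) = 0.
Proof.
rewrite F_atE n_sub2; split=> [|->]; first exact: on_cliff_starV_eq0.
exact: on_cliff0.
Qed.

Lemma E0_iff_E'0_star1 x : Omega_at iota 2 2 x ->
  E_at theta 2 2 x = 0 <-> E'_at star theta 2 2 (on_cliff star x) = 0.
Proof.
move=> xO; rewrite /E'_at (on_cliff_starK n_ge2 xO) n_sub2.
by split=> [->|]; [exact: on_cliff0 | exact: on_cliff_starV_eq0].
Qed.

(** E' R = 0 gives F' R = 0, while F R = 0 reads F' (star_1 R) = 0 and gives
    E' (star_1 R) = 0, that is E R = 0. *)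
Lemma einstein_E_F' x : Omega_at iota 2 2 x ->
  F_at eta iota star theta 2 2 x = 0 -> E'_at star theta 2 2 x = 0 ->
  E_at theta 2 2 x = 0 /\ F'_at eta iota star theta 2 2 x = 0.
Proof.
move=> xO F0 E'0; have sO := Omega_star1 n_ge2 xO; rewrite n_sub2 in sO.
split; last exact/E'0_iff_F'0.
by apply/E0_iff_E'0_star1/E'0_iff_F'0/F0_iff_F'0_star1.
Qed.

(** With m and S the matrices of R and of the star, the symmetry of R and of
    star_1 R reads m^T = m and (S m)^T = S m.  Hence m S^T = S m, and
    S m S^T = S S m = m. *)
Lemma einstein_self_dual x : Omega_at iota 2 2 x ->
  F_at eta iota star theta 2 2 x = 0 -> E'_at star theta 2 2 x = 0 ->
  on_cliff star (star2 star x) = x.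
Proof.
move=> xO F0 E'0; have sO := Omega_star1 n_ge2 xO; rewrite n_sub2 in sO.
have xsym := E'0_pair_symmetric xO E'0.
have := F'0_pair_symmetric sO ((F0_iff_F'0_star1 x).1 F0).
rewrite symbol2_on_cliff trmx_mul xsym => sx.
apply: symbol2_inj; rewrite symbol2_on_cliff symbol2_star2 sx.
by rewrite -symbol2_on_cliff -symbol2_on_cliff (on_cliff_starK n_ge2 xO).
Qed.

End Pointwise.

(** * The bidegree of the curvature *)

Section CliffordDerivatives.

Context (R : realType) (Cl : falgType R[i]) (n : nat).
Implicit Types (f : 'rV[R]_n -> Cl) (z : 'rV[R]_n) (i : 'I_n).
Local Notation e := (vbasis {:Cl}).

Lemma Re_mul (a b : R[i]) :
  complex.Re (a * b) = complex.Re a * complex.Re b - complex.Im a * complex.Im b.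
Proof. by case: a => ? ?; case: b. Qed.

Lemma Im_mul (a b : R[i]) :
  complex.Im (a * b) = complex.Re a * complex.Im b + complex.Im a * complex.Re b.
Proof. by case: a => ? ?; case: b. Qed.

Lemma coord_partial_cliff i f z k : coord e k (partial_cliff i f z) =
  Complex (partial i (fun y => complex.Re (coord e k (f y))) z)
          (partial i (fun y => complex.Im (coord e k (f y))) z).
Proof. exact: (coord_sum_free _ _ (basis_free (vbasisP _))). Qed.

Lemma derive_comb_eq0 (m : nat) (a b : 'I_m -> R) (u v : 'I_m -> 'rV[R]_n -> R) z d :
  (forall l, derivable (u l) z d) -> (forall l, derivable (v l) z d) ->
  (\near z, \sum_l (a l * u l z + b l * v l z) = 0) ->
  \sum_l (a l * 'D_d (u l) z + b l * 'D_d (v l) z) = 0.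
Proof.
move=> du dv near0.
have dh l : is_derive z d (a l \*: u l + b l \*: v l)
    (a l *: 'D_d (u l) z + b l *: 'D_d (v l) z).
  by apply: is_deriveD; apply: is_deriveZ; apply: DeriveDef.
have := @derive_val _ _ _ _ _ _ _ (is_derive_sum dh) => <-.
rewrite -(derive_cst (0 : R) z d); apply: near_eq_derive.
apply: filterS near0 => y y0 /=.
by rewrite /cst -[RHS]y0 fct_sumE; apply: eq_bigr => l _.
Qed.

(** Differentiation commutes with a fixed complex linear map; the real and the
    imaginary part of each coordinate of g (f y) are real linear combinations of
    those of f y. *)
Lemma partial_cliff_ker (g : {linear Cl -> Cl}) i f z :
  (forall k, derivable (fun y => complex.Re (coord e k (f y))) z (delta_mx 0 i)) ->
  (forall k, derivable (fun y => complex.Im (coord e k (f y))) z (delta_mx 0 i)) ->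
  (\near z, g (f z) = 0) -> g (partial_cliff i f z) = 0.
Proof.
move=> dRe dIm near0.
rewrite (coord_vbasis (memvf (g _))) big1 // => k _.
suff -> : coord e k (g (partial_cliff i f z)) = 0 by rewrite scale0r.
rewrite coord_lmx; under eq_bigr do rewrite coord_partial_cliff.
have coord0 : \near z, \sum_l lmx g k l * coord e l (f z) = 0.
  by apply: filterS near0 => y gfy0; rewrite -coord_lmx gfy0 linear0.
apply/eqP; rewrite eq_complex /=; apply/andP; split; apply/eqP.
  rewrite (raddf_sum (@complex.Re R)) /=; under eq_bigr do rewrite Re_mul /= -mulNr.
  apply: derive_comb_eq0 => //; apply: filterS coord0 => y /(congr1 (@complex.Re R)).
  rewrite (raddf_sum (@complex.Re R)) /= => yE; rewrite -[RHS]yE.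
  by apply: eq_bigr => l _; rewrite Re_mul mulNr.
rewrite (raddf_sum (@complex.Im R)) /=; under eq_bigr do rewrite Im_mul /= addrC.
apply: derive_comb_eq0 => //; apply: filterS coord0 => y /(congr1 (@complex.Im R)).
rewrite (raddf_sum (@complex.Im R)) /= => yE; rewrite -[RHS]yE.
by apply: eq_bigr => l _; rewrite Im_mul addrC.
Qed.

(** Membership in W is the vanishing of 1 minus a projection to W. *)
Lemma partial_cliff_mem (W : {vspace Cl}) i f z :
  (forall k, derivable (fun y => complex.Re (coord e k (f y))) z (delta_mx 0 i)) ->
  (forall k, derivable (fun y => complex.Im (coord e k (f y))) z (delta_mx 0 i)) ->
  (\near z, f z \in W) -> partial_cliff i f z \in W.
Proof.
move=> dRe dIm nearW.
have gE a : (\1 - projv W)%VF a = a - projv W a by rewrite !lfunE /= !lfunE.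
have := @partial_cliff_ker (\1 - projv W)%VF i f z dRe dIm.
rewrite /= gE => /(_ _)/eqP; rewrite subr_eq0 => pE.
rewrite (eqP (pE _)) ?memv_proj //.
by apply: filterS nearW => y /projv_id Wy; rewrite /= gE Wy subrr.
Qed.

End CliffordDerivatives.

Section Curvature.

Context (R : realType) (V : vectType R) (eta : {symmetric V}).
Context (Cl : falgType R[i]) (iota : {rlinear V -> Cl}).
Hypothesis Cl_clifford : clifford_algebra eta iota.
Context (al : {lrmorphism Cl -> Cl}).
Hypothesis al_iota : forall v, al (iota v) = - iota v.
Hypothesis alK : involutive al.

Local Notation cwedge := (cwedge iota al).
Local Notation ccontr := (ccontr iota al).

Lemma cwedgeE v a : cwedge v a = 2^-1 *: (iota v * a + al a * iota v).
Proof. by []. Qed.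

Lemma ccontrE v a : ccontr v a = 2^-1 *: (iota v * a - al a * iota v).
Proof. by []. Qed.

(** The commutator of a bivector with a vector is - 2 times a contraction. *)
Lemma Clp1_comm_vector a v : Clp iota 2 a -> Clp iota 1 (a * iota v - iota v * a).
Proof.
move=> a2; have := Clp_ccontr Cl_clifford al_iota alK v a2.
move=> /(ClpZ (- 2)); rewrite ccontrE (al_Clp al_iota a2) sqrrN.
rewrite expr1n scale1r scalerA mulNr divff ?pnatr_eq0 // scaleN1r opprB.
exact.
Qed.

(** Bracketing with the bivector a is a derivation of Cl that maps V to Cl^1, so
    it maps v /\ u to [a, v] /\ u + v /\ [a, u], of degree 2. *)
Lemma Clp2_comm a b : Clp iota 2 a -> Clp iota 2 b -> Clp iota 2 (a * b - b * a).
Proof.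
move=> a2; elim/Clp_ind: b / => [|z b b' Hb Hb'|[|v [|u [|//]]] // _].
- by rewrite mulr0 mul0r subrr; exact: Clp0.
- rewrite mulrDr mulrDl opprD addrACA -scalerAl -scalerAr -scalerBr.
  by apply: ClpD => //; exact: ClpZ.
pose br c := a * c - c * a.
have brM c c' : br (c * c') = br c * c' + c * br c'.
  by rewrite /br mulrBl mulrBr !mulrA addrA subrK.
have uE : wedges iota [:: u] = iota u.
  rewrite (wedges_cons al_iota) cwedgeE rmorph1 mulr1 mul1r -mulr2n.
  by rewrite -scalerMnr scalerMnl -mulr_natr mulVf ?scale1r ?pnatr_eq0.
have br1 w : al (br (iota w)) = - br (iota w).
  by rewrite (al_Clp al_iota (Clp1_comm_vector w a2)) expr1 scaleN1r.
have -> : a * wedges iota [:: v; u] - wedges iota [:: v; u] * a =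
    cwedge v (br (iota u)) - cwedge u (br (iota v)).
  rewrite (wedges_cons al_iota) uE !cwedgeE !br1 al_iota -scalerAr -scalerAl -!scalerBr.
  congr (_ *: _); rewrite !mulNr mulrBr mulrBl.
  transitivity (br (iota v * iota u) - br (iota u * iota v)).
    by rewrite /br !opprD !opprK addrACA.
  by rewrite !brM !opprD !opprK !addrA [LHS](ACl (2*3*4*1)).
by apply: ClpD; [|apply: ClpN]; apply: Clp_cwedge => //; exact: Clp1_comm_vector.
Qed.

(** The coefficient of dx^i /\ dx^j in the square is, up to sign, the commutator
    of the coefficients of dx^i and dx^j. *)
Lemma ext_mul_self_Omega n (x : ext n Cl) :
  Omega_at iota 2 1 x -> Omega_at iota 2 2 (ext_mul x x).
Proof.
move=> xO K.
have mulE : ext_mul x x K = \sum_(i in K) shuffle_sign R[i] [set i] (K :\ i) *: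
    (x [set i] * x (K :\ i)).
  rewrite ffunE sum_subset1 // => I _ I1.
  by have [_ ->] := xO I; rewrite ?mul0r ?scaler0.
split=> [|K2]; last first.
  rewrite mulE big1 // => i iK; have [_ ->] := xO (K :\ i); rewrite ?mulr0 ?scaler0 //.
  by apply: contra K2 => /eqP K1; rewrite (cardsD1 i) iK K1.
have [K2|K2] := eqVneq #|K| 2%N; last first.
  rewrite mulE big1; first exact: Clp0.
  move=> i iK; have [_ ->] := xO (K :\ i); rewrite ?mulr0 ?scaler0 //.
  by apply: contra K2 => /eqP K1; rewrite (cardsD1 i) iK K1.
have /cards2P [i [j [ij KE]]] : #|K| == 2 by rewrite K2.
rewrite mulE KE big_setU1 ?inE //= big_set1.
have -> : [set i; j] :\ i = [set j].
  by apply/setP => k; rewrite !inE; case: eqVneq => // ->; rewrite (negPf ij).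
have -> : [set i; j] :\ j = [set i].
  by apply/setP => k; rewrite !inE orbC; case: eqVneq => //= ->; rewrite eq_sym (negPf ij).
rewrite (shuffle_sign_r1 _ (I := [set j])) ?inE // cards1 expr1 mulN1r.
rewrite scaleNr -scalerBr; apply: ClpZ.
by apply: Clp2_comm; [case: (xO [set i]) | case: (xO [set j])].
Qed.

End Curvature.

Lemma Clp_vspace (R : realType) (V : vectType R) (eta : {symmetric V})
    (Cl : falgType R[i]) (iota : {rlinear V -> Cl})
    (Cl_clifford : clifford_algebra eta iota)
    (al : {lrmorphism Cl -> Cl}) (al_iota : forall v, al (iota v) = - iota v)
    (alK : involutive al) (n : nat) (xi sh : 'I_n -> V)
    (sh_expand : forall v, v = \sum_i eta (xi i) v *: sh i) (p : nat) :
  exists W : {vspace Cl}, forall a, Clp iota p a <-> a \in W.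
Proof.
pose wI (I : {set 'I_n}) := wedges iota [seq sh i | i <- enum I].
exists (\sum_(I : {set 'I_n} | #|I| == p) <[wI I]>)%VS => a; split.
  elim/(Clp_ind_coframe Cl_clifford al_iota alK sh_expand): a /.
  - exact: mem0v.
  - by move=> z a b Ha Hb; rewrite memvD // memvZ.
  by move=> I /eqP Ip; rewrite memvE (sumv_sup I).
case/memv_sumP => v vI ->; apply: Clp_sum => I Ip.
have /vlineP [k ->] := vI I Ip; apply: ClpZ.
by rewrite -(eqP Ip) cardE -(size_map sh); exact: Clp_wedges.
Qed.

Section CurvatureDegree.

Context (R : realType) (V : vectType R) (eta : {symmetric V}).
Context (Cl : falgType R[i]) (iota : {rlinear V -> Cl}).
Hypothesis Cl_clifford : clifford_algebra eta iota.
Context (al : {lrmorphism Cl -> Cl}).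
Hypothesis al_iota : forall v, al (iota v) = - iota v.
Hypothesis alK : involutive al.
Context (n : nat) (M : topologicalType) (A : smooth_atlas R n M).

Lemma Omega_at_add p q (x y : ext n Cl) :
  Omega_at iota p q x -> Omega_at iota p q y -> Omega_at iota p q (x + y).
Proof.
move=> xO yO I; rewrite ffunE; have [xp xq] := xO I; have [yp yq] := yO I.
by split=> [|Iq]; [exact: ClpD | rewrite xq ?yq ?addr0].
Qed.

Lemma partial_form_mem (x : mform A Cl) (W : {vspace Cl}) p q c z i (I : {set 'I_n}) :
  Omega iota p q x -> chart_img c z ->
  (forall y, chart_img c y -> x c y I \in W) ->
  partial_cliff i (fun y => x c y I) z \in W.
Proof.
move=> [_ x_smooth _] cz xW; apply: partial_cliff_mem.
- by move=> k; have [/(_ 1%N) [_ /(_ i) [+ _]] _] := x_smooth c I k; apply.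
- by move=> k; have [_ /(_ 1%N) [_ /(_ i) [+ _]]] := x_smooth c I k; apply.
by apply: filterS xW _; apply: open_nbhs_nbhs; split; first exact: chart_img_open.
Qed.

Lemma fd_Omega (x : mform A Cl) (p q : nat) c z (W : {vspace Cl}) :
  (forall a, Clp iota p a <-> a \in W) ->
  Omega iota p q x -> chart_img c z -> Omega_at iota p q.+1 (fd x c z).
Proof.
move=> WP xO cz K; rewrite ffunE; have [x_at _ _] := xO; split.
  apply: Clp_sum => i iK; apply/ClpZ/WP; apply: (partial_form_mem _ xO) => // y cy.
  by apply/WP; case: (x_at c y cy (K :\ i)).
move=> Kq; apply: big1 => i iK; suff -> : partial_cliff i (fun y => x c y (K :\ i)) z = 0.
  by rewrite scaler0.
apply/eqP; rewrite -memv0; apply: (partial_form_mem _ xO) => // y cy.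
have [_ ->] := x_at c y cy (K :\ i); first exact: mem0v.
by apply: contra Kq => /eqP <-; rewrite (cardsD1 i) iK.
Qed.

Lemma curvature_Omega (omega : mform A Cl) c z (W : {vspace Cl}) :
  (forall a, Clp iota 2 a <-> a \in W) ->
  Omega iota 2 1 omega -> chart_img c z -> Omega_at iota 2 2 (curvature omega c z).
Proof.
move=> WP oO cz; apply: Omega_at_add; first exact: fd_Omega WP oO cz.
apply: (ext_mul_self_Omega Cl_clifford al_iota alK).
by case: oO => /(_ c z cz).
Qed.

End CurvatureDegree.

(** * Commuting involutions *)

Section Involutions.

Context (K : numFieldType) (M : lmodType K).
Implicit Types (S : {linear M -> M}) (x : M).

Definition eigenproj S (s : bool) x : M := 2^-1 *: (x + (-1) ^+ s *: S x).

Lemma eigenproj_sum S x : x = eigenproj S false x + eigenproj S true x.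
Proof.
rewrite /eigenproj -scalerDr expr0 expr1 scale1r scaleN1r addrACA subrr addr0.
by rewrite -mulr2n -[x *+ 2]scaler_nat scalerA mulVf ?scale1r ?pnatr_eq0.
Qed.

Lemma eigenprojP S s x : S (S x) = x -> S (eigenproj S s x) = (-1) ^+ s *: eigenproj S s x.
Proof.
move=> SS; rewrite /eigenproj linearZ linearD linearZ /= SS scalerA mulrC -scalerA.
congr (_ *: _); rewrite scalerDr scalerA -expr2 sqrr_sign scale1r.
by rewrite addrC.
Qed.

Context (S1 S2 : {linear M -> M}) (x : M).
Hypothesis S11 : S1 (S1 x) = x.
Hypothesis S22 : S2 (S2 x) = x.
Hypothesis S12 : forall y, S1 (S2 y) = S2 (S1 y).

(* The expression of [eigenpart] for S1 = star_1 and S2 = star_2. *)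
Let part (s t : bool) : M :=
  4^-1 *: (x + (-1) ^+ s *: S1 x + (-1) ^+ t *: S2 x + (-1) ^+ (s + t) *: S1 (S2 x)).

Let scaler2C (k : K) (y : M) : k *: (2^-1 *: y) = 2^-1 *: (k *: y).
Proof. by rewrite !scalerA mulrC. Qed.

Lemma part_proj21 s t : part s t = eigenproj S2 t (eigenproj S1 s x).
Proof.
rewrite /part /eigenproj (linearZZ S2) (linearD S2) (linearZZ S2) -S12 exprD.
rewrite [_ ^+ _ *: (2^-1 *: _)]scaler2C -[2^-1 *: _ + _]scalerDr [RHS]scalerA -invfM -natrM.
by rewrite [_ ^+ t *: (_ + _)]scalerDr [_ ^+ t *: (_ *: _)]scalerA addrA [_ ^+ t * _]mulrC.
Qed.

Lemma part_proj12 s t : part s t = eigenproj S1 s (eigenproj S2 t x).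
Proof.
rewrite /part /eigenproj (linearZZ S1) (linearD S1) (linearZZ S1) exprD.
rewrite [_ ^+ _ *: (2^-1 *: _)]scaler2C -[2^-1 *: _ + _]scalerDr [RHS]scalerA -invfM -natrM.
by rewrite [_ ^+ s *: (_ + _)]scalerDr [_ ^+ s *: (_ *: _)]scalerA addrA [x + _ + _]addrAC.
Qed.

Lemma parts_sum : x = part false false + part false true + (part true false + part true true).
Proof. by rewrite !part_proj21 -!eigenproj_sum. Qed.

Lemma S1_part s t : S1 (part s t) = (-1) ^+ s *: part s t.
Proof.
rewrite part_proj12; apply: eigenprojP.
by rewrite /eigenproj !(linearZZ S1, linearD S1) !S12 S11.
Qed.

Lemma S2_part s t : S2 (part s t) = (-1) ^+ t *: part s t.
Proof.
rewrite part_proj21; apply: eigenprojP.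
by rewrite /eigenproj !(linearZZ S2, linearD S2) -!S12 S22.
Qed.

(** If S1 S2 x = x then S1 x = S2 x, and the mixed parts cancel termwise.
    Conversely S1 S2 is the identity on the two parts with equal signs. *)
Lemma fixed_iff_mixed_parts0 :
  S1 (S2 x) = x <-> part false true = 0 /\ part true false = 0.
Proof.
split=> [x12|[ft tf]].
  have S1x : S1 x = S2 x by rewrite -{1}x12 !S12 S11.
  rewrite /part x12 S1x !(expr0, expr1, scale1r, scaleN1r) !(addrK, subrK, subrr) /=.
  by rewrite scaler0.
rewrite [in RHS]parts_sum [in LHS]parts_sum ft tf addr0 add0r.
rewrite (linearD S2) !S2_part expr0 expr1 scale1r scaleN1r.
by rewrite (linearD S1) (linearN S1) !S1_part expr0 expr1 scale1r scaleN1r opprK.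
Qed.

End Involutions.

(** * Einstein equation, invariance and self-duality *)

Section FormMaps.

Context (R : realType) (V : vectType R) (eta : V -> V -> R).
Context (Cl : falgType R[i]) (iota : V -> Cl) (n : nat) (theta : ext n Cl).

Lemma on_cliff_is_linear (f : 'End(Cl)) : linear (@on_cliff R Cl n f).
Proof. by move=> z x y; apply/ffunP => I; rewrite !ffunE linearP. Qed.

HB.instance Definition _ f :=
  GRing.isLinear.Build R[i] (ext n Cl) (ext n Cl) _ (@on_cliff R Cl n f) (on_cliff_is_linear f).

Lemma on_form_is_linear (f : 'End(Cl)) : linear (on_form eta iota theta f).
Proof.
move=> z x y; apply/ffunP => K; rewrite !ffunE scaler_sumr -big_split.
by apply: eq_bigr => I _; rewrite /= !ffunE scalerDr !scalerA mulrC.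
Qed.

HB.instance Definition _ f :=
  GRing.isLinear.Build R[i] (ext n Cl) (ext n Cl) _ (on_form eta iota theta f) (on_form_is_linear f).

End FormMaps.

Theorem mainTheorem4
  (R : realType)
  (V : vectType R) (dimV : \dim {:V} = 4%N)
  (eta : {symmetric V}) (eta_nondeg : nondegenerate eta)
  (Cl : falgType R[i]) (iota : {rlinear V -> Cl})
  (Cl_clifford : clifford_algebra eta iota)
  (vol : Cl) (vol_top : Clp iota 4 vol) (vol_sqr : vol * vol = 1)
  (star : 'End(Cl)) (star_hodge : hodge_star iota vol star)
  (M : topologicalType) (M_hausdorff : hausdorff_space M)
  (M_countable : @second_countable M) (A : smooth_atlas R 4 M)
  (theta omega : mform A Cl)
  (theta_form : Omega iota 1 1 theta)
  (theta_nondeg : nondegenerate_form iota theta)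
  (omega_form : Omega iota 2 1 omega)
  (torsion_free : vanishes (torsion theta omega)) :
  let Rc := curvature omega in
  let s1 (x : mform A Cl) := star1 star x in
  let s2 := star2 eta iota star theta in
  let part := eigenpart eta iota star theta in
  let invariant := sl2sl2_invariant eta iota star theta 2 2 Rc in
  [/\ (vanishes (opF eta iota star theta 2 2 Rc) /\
       vanishes (opE' star theta 2 2 Rc)) <-> invariant,
      invariant ->
        pair_symmetric eta iota theta Rc /\ self_dual eta iota star theta Rc,
      forall x : mform A Cl, Omega iota 2 2 x ->
        [/\ feq (s1 (s1 x)) x, feq (s2 (s2 x)) x & feq (s1 (s2 x)) (s2 (s1 x))],
      feq Rc (fadd (fadd (part false false Rc) (part false true Rc))
                   (fadd (part true false Rc) (part true true Rc))) /\
      (forall s t : bool,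
        feq (s1 (part s t Rc)) (fscale ((-1) ^+ s) (part s t Rc)) /\
        feq (s2 (part s t Rc)) (fscale ((-1) ^+ t) (part s t Rc)))
    & self_dual eta iota star theta Rc <->
        (vanishes (part false true Rc) /\ vanishes (part true false Rc))].
Proof.
move=> Rc s1 s2 part invariant.
have [al [al_iota alK]] := grading_exists Cl_clifford.
have theta_deg c z : chart_img c z -> forall I : {set 'I_4}, #|I| != 1%N -> theta c z I = 0.
  by move=> cz I; case: theta_form => /(_ c z cz I) [].
have frame c z (cz : chart_img c z) :=
  coframe_of_nondegenerate eta_nondeg Cl_clifford (theta_nondeg c z cz).
have Rc22 c z : chart_img c z -> Omega_at iota 2 2 (Rc c z).
  move=> cz; have [xi [_ _ sh_expand]] := frame c z cz.
  have [W WP] := Clp_vspace Cl_clifford al_iota alK sh_expand 2.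
  exact: (curvature_Omega Cl_clifford al_iota alK WP).
have s1K (c : chart A) z (x : ext 4 Cl) : chart_img c z -> Omega_at iota 2 2 x ->
    on_cliff star (on_cliff star x) = x.
  move=> cz xO; have [xi [txi xish shE]] := frame c z cz.
  exact: (on_cliff_starK Cl_clifford al_iota alK xish shE dimV isT vol_top vol_sqr
           star_hodge _ xO).
have s2K (c : chart A) z (x : ext 4 Cl) : chart_img c z ->
    on_form eta iota (theta c z) star (on_form eta iota (theta c z) star x) = x.
  move=> cz; have [xi [txi xish shE]] := frame c z cz.
  exact: (on_form_starK Cl_clifford al_iota alK xish shE dimV isT vol_top vol_sqr star_hodge).
have s12 (c : chart A) z (x : ext 4 Cl) : chart_img c z ->
    on_cliff star (on_form eta iota (theta c z) star x) =
    on_form eta iota (theta c z) star (on_cliff star x).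
  move=> cz; have [xi [txi xish shE]] := frame c z cz.
  exact: (star12C Cl_clifford al_iota alK xish shE dimV star_hodge).
have einstein c z : chart_img c z ->
    F_at eta iota star (theta c z) 2 2 (Rc c z) = 0 ->
    E'_at star (theta c z) 2 2 (Rc c z) = 0 ->
    [/\ E_at (theta c z) 2 2 (Rc c z) = 0,
        F'_at eta iota star (theta c z) 2 2 (Rc c z) = 0,
        symmetric_at eta iota (theta c z) (Rc c z)
      & on_cliff star (on_form eta iota (theta c z) star (Rc c z)) = Rc c z].
  move=> cz F0 E'0; have [xi [txi xish shE]] := frame c z cz.
  have RcO := Rc22 c z cz.
  have [E0 F'0] := einstein_E_F' Cl_clifford al_iota alK txi (theta_deg c z cz) xish shE
    dimV isT vol_top vol_sqr star_hodge erefl RcO F0 E'0.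
  split=> //.
    exact: (E'0_pair_symmetric Cl_clifford al_iota alK txi (theta_deg c z cz) shE
      dimV star_hodge erefl RcO E'0).
  exact: (einstein_self_dual Cl_clifford al_iota alK txi (theta_deg c z cz) xish shE
    dimV isT vol_top vol_sqr star_hodge erefl RcO F0 E'0).
pose S1 : {linear ext 4 Cl -> ext 4 Cl} := on_cliff star.
pose S2 c z : {linear ext 4 Cl -> ext 4 Cl} := on_form eta iota (theta c z) star.
split.
- split=> [[F0 E'0]|[[_ F0 _] [E'0 _ _]]] //.
  have H0 : (2 + 2 - 4%:R : R[i]) = 0 by rewrite -(natrD _ 2 2) subrr.
  split; split=> // c z cz.
  + by have [] := einstein c z cz (F0 c z cz) (E'0 c z cz).
  + by rewrite /opH /H_at H0 scale0r.
  + by have [] := einstein c z cz (F0 c z cz) (E'0 c z cz).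
  + by rewrite /opH' /H'_at subrr scale0r.
- case=> [[_ F0 _] [E'0 _ _]]; split=> c z cz.
    by have [] := einstein c z cz (F0 c z cz) (E'0 c z cz).
  by have [] := einstein c z cz (F0 c z cz) (E'0 c z cz).
- move=> x [x22 _ _]; split=> c z cz.
  + exact: s1K cz (x22 c z cz).
  + exact: s2K cz.
  + exact: s12 cz.
- split=> [c z cz|s t].
    exact: (parts_sum (S1 := S1) (S2 := S2 c z) (Rc c z) (fun y => s12 c z y cz)).
  split=> c z cz.
    exact: (S1_part (S1 := S1) (S2 := S2 c z) (s1K c z _ cz (Rc22 c z cz))
      (fun y => s12 c z y cz)).
  exact: (S2_part (S1 := S1) (S2 := S2 c z) (s2K c z _ cz) (fun y => s12 c z y cz)).
have fixedP c z (cz : chart_img c z) := fixed_iff_mixed_parts0 (S1 := S1) (S2 := S2 c z)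
  (s1K c z _ cz (Rc22 c z cz)) (s2K c z _ cz) (fun y => s12 c z y cz).
split=> [sd|[ft tf] c z cz].
  by split=> c z cz; have [] := (fixedP c z cz).1 (sd c z cz).
by apply/(fixedP c z cz).2; split; [exact: ft | exact: tf].
Qed.
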